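(* For all $n\ge 1$, $$\omega\tilde W_n(\mathbf{x},t)=\sum_{\sigma\in\mathfrak{S}_n}t^{\mathrm{cdes}(\sigma)}F_{n,\mathrm{DES}_{\ge2}(\sigma^{-1})}(\mathbf{x}).$$
   Context: For $n\ge 1$, $W_n$ is the set of Smirnov words of length $n$: words $w=w_1\cdots w_n$ over the positive integers with $w_i\ne w_{i+1}$ for all $1\le i\le n-1$ (the first and last letters may be equal). Let $\mathbf{x}=x_1,x_2,\dots$ be indeterminates and $x_w:=x_{w_1}\cdots x_{w_n}$. The cyclic descent number of a word or permutation is $\mathrm{cdes}(w):=|\{i\in\{1,\dots,n\}: w_i>w_{i+1}\}|$, where $w_{n+1}:=w_1$ (for $\sigma\in\mathfrak{S}_n$ use the word $\sigma(1)\cdots\sigma(n)$). Define $\tilde W_n(\mathbf{x},t):=\sum_{w\in W_n} t^{\mathrm{cdes}(w)}x_w$; it is a polynomial in $t$ with symmetric function coefficients. $\omega$ is the standard involution on symmetric functions taking $e_n$ to $h_n$, applied coefficientwise in $t$. For $S\subseteq\{1,\dots,n-1\}$, the fundamental quasisymmetric function is $F_{n,S}(\mathbf{x}):=\sum_f x_{f(1)}\cdots x_{f(n)}$, summed over all functions $f:\{1,\dots,n\}\to\{1,2,3,\dots\}$ with $f(i)\ge f(i+1)$ for all $i\in\{1,\dots,n-1\}$ and $f(i)>f(i+1)$ for all $i\in S$. For $\sigma\in\mathfrak{S}_n$, $\mathrm{DES}_{\ge2}(\sigma):=\{i\in\{1,\dots,n-1\}:\sigma(i)-\sigma(i+1)\ge2\}$.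 *)

(* Defs.v *)
From HB Require Import structures.
From mathcomp Require Import all_boot all_order all_fingroup all_algebra.
From mathcomp Require Import finmap multiset.
From mathcomp.multinomials Require Import -(notations) mpoly.
From mathcomp Require Import boolp classical_sets functions cardinality fsbigop.

Set Implicit Arguments.
Unset Strict Implicit.
Unset Printing Implicit Defensive.
Import Order.TTheory GRing.Theory.
Local Open Scope classical_set_scope.
Local Open Scope ring_scope.

Notation mon := {mset nat}%mset.

(* Formal power series over the integers in countably many variables; the
   monomial prod_i x_i^(m i) is the multiset m of its variable indices. *)
Record fps := Fps { fcoef : mon -> int }.

Lemma fpsP (f g : fps) : fcoef f =1 fcoef g -> f = g.
Proof. by case: f g => f [g] /= /funext ->. Qed.

HB.instance Definition _ := gen_eqMixin fps.
HB.instance Definition _ := gen_choiceMixin fps.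

Definition fps0 : fps := Fps (fun _ => 0).
Definition fps1 : fps := Fps (fun m => (m == mset0)%:R).
Definition fps_opp (f : fps) : fps := Fps (fun m => - fcoef f m).
Definition fps_add (f g : fps) : fps := Fps (fun m => fcoef f m + fcoef g m).
Definition fps_mul (f g : fps) : fps :=
  Fps (fun m => \sum_(p \in [set p : mon * mon | (p.1 `+` p.2)%mset = m])
                   fcoef f p.1 * fcoef g p.2).

Definition msplit (m : mon) : seq (mon * mon) :=
  undup [seq (seq_mset (mask b m), (m `\` seq_mset (mask b m))%mset)
        | b <- [seq tval b | b <- enum {: (size m).-tuple bool}]].

Lemma mem_msplit m p : (p \in msplit m) = ((p.1 `+` p.2)%mset == m).
Proof.
rewrite mem_undup; apply/mapP/eqP => [[b _ ->] /=|<-].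
  apply/msetP => a; rewrite !msetE2 mset_seqE subnKC //.
  by rewrite -(count_mem_mset a m); apply: leq_count_mask.
case: p => a c /=; set m' := (a `+` c)%mset.
have /count_subseqP[s /subseqP[b sb ->] pa] :
    forall x : nat, (count_mem x (enum_mset a) <= count_mem x (enum_mset m'))%N.
  by move=> x; rewrite !count_mem_mset msetE2 leq_addr.
have ea : seq_mset (mask b m') = a.
  by rewrite -[RHS]seq_mset_id; apply/eq_seq_msetP; rewrite perm_sym.
exists b; last by congr (_, _) => //; apply/msetP => x;
  rewrite ea !msetE2 addKn.
have sb' : size b == size m' by apply/eqP.
by apply/mapP; exists (Tuple sb'); rewrite ?mem_enum.
Qed.

Lemma fcoefM_split f g m :
  fcoef (fps_mul f g) m = \sum_(p <- msplit m) fcoef f p.1 * fcoef g p.2.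
Proof.
rewrite /= (fsbigE (msplit m)) ?undup_uniq //.
- by rewrite [RHS]big_seq [LHS]big_seq_cond; apply: eq_bigl => p;
    rewrite mem_msplit andbC; case: eqP => e; rewrite ?andbT ?andbF //;
    apply/idP; rewrite inE.
- by move=> p /=; rewrite mem_msplit => /eqP.
- by move=> p /= e; rewrite mem_msplit e eqxx.
Qed.

Lemma fcoefD f g m : fcoef (fps_add f g) m = fcoef f m + fcoef g m.
Proof. by []. Qed.

Lemma fps_addA : associative fps_add.
Proof. by move=> f g h; apply: fpsP => m /=; rewrite addrA. Qed.
Lemma fps_addC : commutative fps_add.
Proof. by move=> f g; apply: fpsP => m /=; rewrite addrC. Qed.
Lemma fps_add0 : left_id fps0 fps_add.
Proof. by move=> f; apply: fpsP => m /=; rewrite add0r. Qed.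
Lemma fps_addN : left_inverse fps0 fps_opp fps_add.
Proof. by move=> f; apply: fpsP => m /=; rewrite addNr. Qed.

HB.instance Definition _ :=
  GRing.isZmodule.Build fps fps_addA fps_addC fps_add0 fps_addN.

Lemma fps_mulC : commutative fps_mul.
Proof.
move=> f g; apply: fpsP => m; rewrite !fcoefM_split.
pose sw (p : mon * mon) := (p.2, p.1).
have swK : involutive sw by case.
rewrite (perm_big [seq sw p | p <- msplit m]); last first.
  apply: uniq_perm; rewrite ?undup_uniq //.
    by rewrite map_inj_uniq ?undup_uniq //; apply: inv_inj.
  case=> a b; apply/idP/mapP => [h|[[c d] h [-> ->]]].
    by exists (b, a) => //; move: h; rewrite !mem_msplit /= msetDC.
  by move: h; rewrite !mem_msplit /= msetDC.
by rewrite big_map; apply: eq_bigr => p _; rewrite mulrC.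
Qed.

Lemma fps_mul1 : left_id fps1 fps_mul.
Proof.
move=> f; apply: fpsP => m; rewrite fcoefM_split.
rewrite (bigD1_seq (mset0, m)) ?undup_uniq //=; last first.
  by rewrite mem_msplit /= mset0D.
rewrite eqxx mul1r big1_seq ?addr0 // => -[a b] /=.
rewrite mem_msplit => /andP[+ /eqP /= ab].
have [a0|an _] := eqVneq a mset0; last by rewrite mul0r.
by rewrite -ab a0 mset0D eqxx.
Qed.

Lemma fps_mulDl : left_distributive fps_mul fps_add.
Proof.
move=> f g h; apply: fpsP => m; rewrite fcoefD !fcoefM_split -big_split.
by apply: eq_bigr => p _; rewrite fcoefD mulrDl.
Qed.

Lemma fps_mulA : associative fps_mul.
Proof.
move=> f g h; apply: fpsP => m; rewrite !fcoefM_split.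
pose F (t : mon * mon * mon) := fcoef f t.1.1 * fcoef g t.1.2 * fcoef h t.2.
transitivity (\sum_(t <- [seq (p.1, q.1, q.2) | p <- msplit m, q <- msplit p.2])
                 F t).
  rewrite big_allpairs_dep; apply: eq_bigr => p _.
  by rewrite fcoefM_split big_distrr /=; apply: eq_bigr => q _; rewrite mulrA.
transitivity (\sum_(t <- [seq (q.1, q.2, p.2) | p <- msplit m, q <- msplit p.1])
                 F t); last first.
  rewrite big_allpairs_dep; apply: eq_bigr => p _.
  by rewrite fcoefM_split big_distrl.
apply: perm_big; apply: uniq_perm.
- apply: allpairs_uniq_dep; rewrite ?undup_uniq //; try by move=> *; exact: undup_uniq.
  move=> _ _ /allpairsPdep[[a b] [[c d] [h1 h2 ->]]]
    /allpairsPdep[[a' b'] [[c' d'] [h1' h2' ->]]] /= [ea ec ed].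
  move: h2 h2'; rewrite !mem_msplit /= => /eqP <- /eqP <-.
  by rewrite ea ec ed.
- apply: allpairs_uniq_dep; rewrite ?undup_uniq //; try by move=> *; exact: undup_uniq.
  move=> _ _ /allpairsPdep[[a b] [[c d] [h1 h2 ->]]]
    /allpairsPdep[[a' b'] [[c' d'] [h1' h2' ->]]] /= [ea ec ed].
  move: h2 h2'; rewrite !mem_msplit /= => /eqP <- /eqP <-.
  by rewrite ea ec ed.
- move=> [[a b] c]; apply/allpairsPdep/allpairsPdep => -[[x y] [[z t] /=]];
    rewrite !mem_msplit /= => -[/eqP e1 /eqP e2 [-> -> ->]].
    exists ((x `+` z)%mset, t), (x, z); rewrite !mem_msplit /= eqxx; split => //.
    by rewrite -msetDA e2 e1.
  exists (z, (t `+` y)%mset), (t, y); rewrite !mem_msplit /= eqxx; split => //.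
  by rewrite msetDA e2 e1.
Qed.

Lemma fps1_neq0 : fps1 != 0.
Proof. by apply/eqP => /(congr1 (fun f => fcoef f mset0)) /=; rewrite eqxx. Qed.

HB.instance Definition _ := GRing.Zmodule_isComNzRing.Build fps
  fps_mulA fps_mulC fps_mul1 fps_mulDl fps1_neq0.

(* Letters and variable indices are [nat]: the letter k stands for the positive
   integer k+1, i.e. for the variable x_(k+1). *)
Definition word_mon n (w : n.-tuple nat) : mon := seq_mset w.

(* The formal sum of the monomials [x w] for w in A.  The inner sum is 0 when
   infinitely many w in A have the same monomial; for words of a fixed length
   there are only finitely many. *)
Definition formal_sum (T : choiceType) (A : set T) (x : T -> mon) : fps :=
  Fps (fun m => \sum_(w \in A `&` [set w | x w = m]) (1 : int)).

Definition sym_e k : fps :=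
  formal_sum [set w : k.-tuple nat | sorted ltn w] (@word_mon k).

Definition sym_h k : fps :=
  formal_sum [set w : k.-tuple nat | sorted leq w] (@word_mon k).

(* A polynomial in b 0, b 1, ... given as a list of (coefficient, product). *)
Definition poly_in (b : nat -> fps) (s : seq (int * seq nat)) : fps :=
  \sum_(t <- s) (\prod_(k <- t.2) b k) *~ t.1.

(* Symmetric functions are the polynomials in the e_k; omega sends P(e_1, ...)
   to P(h_1, ...), see [omegaE] for the independence of the choice of P.
   Outside of the symmetric functions it takes the junk value 0. *)
Definition omega (f : fps) : fps :=
  xget 0 [set g | exists2 s, f = poly_in sym_e s & g = poly_in sym_h s].

Definition smirnov n (w : n.-tuple nat) : bool := sorted (fun a b => a != b) w.

(* [ordS] is the cyclic successor of 'I_n. *)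
Definition cdes n (w : n.-tuple nat) : nat :=
  #|[pred i : 'I_n | (tnth w (ordS i) < tnth w i)%N]|.

(* Collected by powers of t = 'X, using that cdes w <= n. *)
Definition smirnovW n : {poly fps} :=
  \poly_(j < n.+1) formal_sum [set w | smirnov w /\ cdes w = j] (@word_mon n).

(* The position i : 'I_n.-1 stands for i+1 in {1, ..., n-1}. *)
Definition fundF n (S : {set 'I_n.-1}) : fps :=
  formal_sum
    [set f : n.-tuple nat |
       (forall i : 'I_n.-1, nth 0 f i.+1 <= nth 0 f i)%N /\
       (forall i : 'I_n.-1, i \in S -> nth 0 f i.+1 < nth 0 f i)%N]
    (@word_mon n).

Definition perm_word n (s : 'S_n) : n.-tuple nat :=
  [tuple nat_of_ord (s i) | i < n].

Definition DESge2 n (s : 'S_n) : {set 'I_n.-1} :=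
  [set i : 'I_n.-1 |
     (nth 0 (perm_word s) i.+1 + 2 <= nth 0 (perm_word s) i)%N]%SET.

Lemma fcoef_formal_sum (T : choiceType) (A : set T) (x : T -> mon) m (r : seq T) :
  uniq r -> (forall w, w \in r <-> A w /\ x w = m) ->
  fcoef (formal_sum A x) m = (size r)%:R.
Proof.
move=> ur rP; rewrite /= (fsbigE r) //.
- rewrite -sum1_size natr_sum [LHS]big_seq_cond [RHS]big_seq_cond.
  apply: eq_bigl => w; rewrite andbT andbC andb_idl // => wr.
  by apply/mem_set/rP.
- by move=> w /= /rP.
- by move=> w /= /rP ->.
Qed.

Lemma word_mon_eq n (w : n.-tuple nat) (m : mon) :
  word_mon w = m <-> perm_eq w (enum_mset m).
Proof.
by rewrite -[m in X in X <-> _]seq_mset_id; split=> [/eq_seq_msetP|h];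
  last exact/eq_seq_msetP.
Qed.

Lemma fcoef_sym_e k m :
  fcoef (sym_e k) m = ((size (enum_mset m) == k) && uniq (enum_mset m))%:R.
Proof.
pose s := sort leq (enum_mset m).
pose r : seq (k.-tuple nat) := if uniq (enum_mset m) then pmap insub [:: s] else [::].
rewrite (fcoef_formal_sum (r := r)).
- rewrite /r; case: ifP => um; rewrite ?andbF //= andbT.
  by case: insubP => [w|]; rewrite size_sort; [move=> -> | move/negbTE => ->].
- rewrite /r; case: ifP => // _; exact/pmap_sub_uniq.
- move=> w; rewrite /= word_mon_eq ltn_sorted_uniq_leq; rewrite /r; split.
    case: ifP => // um; rewrite mem_pmap_sub inE => /eqP e.
    by rewrite -[tval w]/(val w) e sort_uniq um sort_sorted ?perm_sort //;
      exact: leq_total.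
  case=> /andP[uw sw] pw; rewrite -(perm_uniq pw) uw mem_pmap_sub inE.
  apply/eqP/(sorted_eq leq_trans anti_leq) => //.
    exact/sort_sorted/leq_total.
  by rewrite perm_sym perm_sort perm_sym.
Qed.

Lemma sym_h0 : sym_h 0 = 1.
Proof.
apply: fpsP => m; rewrite (fcoef_formal_sum (r := [seq w <- [:: [tuple]] | m == mset0])).
- by rewrite size_filter /= addn0.
- exact: filter_uniq.
- move=> w; rewrite mem_filter inE tuple0 eqxx andbT /=.
  rewrite word_mon_eq; split=> [/eqP ->|[_]]; first by rewrite enum_mset0.
  by rewrite perm_sym => /perm_nilP h; apply/eqP/msetP => a;
     rewrite -count_mem_mset h mset0E.
Qed.

Section OmegaWellDefined.
Variable K : nat.

Definition emb (m : multinom K) : mon :=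
  seq_mset (flatten [seq nseq (m i) (nat_of_ord i) | i <- enum 'I_K]).

Lemma embE m a : emb m a = (\sum_(i < K) (nat_of_ord i == a) * m i)%N.
Proof.
rewrite mset_seqE count_flatten -map_comp sumnE big_map big_enum /=.
by apply: eq_bigr => i _; rewrite count_nseq.
Qed.

Lemma emb_ord m (i : 'I_K) : emb m i = m i.
Proof.
rewrite embE (bigD1 i) //= eqxx mul1n big1 ?addn0 // => j ji.
by rewrite (inj_eq val_inj) (negbTE ji).
Qed.

Lemma emb_ge m a : (K <= a)%N -> emb m a = 0%N.
Proof. by move=> Ka; rewrite embE big1 // => i _; rewrite ltn_eqF // (leq_trans _ Ka). Qed.

Lemma emb_inj : injective emb.
Proof. by move=> m m' e; apply/mnmP => i; rewrite -!emb_ord e. Qed.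

Lemma embP (M : mon) (m : multinom K) :
  (forall i : 'I_K, M i = m i) -> (forall a, (K <= a)%N -> M a = 0%N) -> M = emb m.
Proof.
move=> h1 h2; apply/msetP => a; case: (ltnP a K) => aK; last by rewrite h2 ?emb_ge.
by have := h1 (Ordinal aK); rewrite -emb_ord.
Qed.

Lemma embD m m' : emb (mnm_add m m') = (emb m `+` emb m')%mset.
Proof.
symmetry; apply: embP => [i|a Ka]; rewrite msetE2 ?emb_ord ?mnmDE //.
by rewrite !emb_ge.
Qed.

Lemma emb0 : emb (@mnm0 K) = mset0.
Proof. by symmetry; apply: embP => *; rewrite mset0E ?mnm0E. Qed.

Lemma size_emb m : size (enum_mset (emb m)) = mdeg m.
Proof.
rewrite (perm_size (perm_eq_seq_mset _)) size_flatten /shape -map_comp sumnE.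
by rewrite big_map big_enum mdegE /=; apply: eq_bigr => i _; rewrite size_nseq.
Qed.

Definition agree (f : fps) (p : mpoly K int) :=
  forall m, mcoeff m p = fcoef f (emb m).

Lemma agree1 : agree 1 1.
Proof. by move=> m; rewrite mcoeff1 /= -emb0 (inj_eq emb_inj). Qed.

Lemma agree0 : agree 0 0.
Proof. by move=> m; rewrite mcoeff0. Qed.

Lemma agreeD f g p q : agree f p -> agree g q -> agree (f + g) (p + q).
Proof. by move=> h1 h2 m; rewrite mcoeffD h1 h2. Qed.

Lemma agreeN f p : agree f p -> agree (- f) (- p).
Proof. by move=> h1 m; rewrite mcoeffN h1. Qed.

Lemma agreeMn f p n : agree f p -> agree (f *+ n) (p *+ n).
Proof.
by move=> h; elim: n => [|n IH]; rewrite ?mulr0n ?mulrS; [exact: agree0|exact: agreeD].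
Qed.

Lemma agreeMz f p (z : int) : agree f p -> agree (f *~ z) (p *~ z).
Proof.
move=> h; case: z => n; first exact: agreeMn.
by rewrite NegzE !mulrNz; apply/agreeN/agreeMn.
Qed.

Lemma agreeM f g p q : agree f p -> agree g q -> agree (f * g) (p * q).
Proof.
move=> h1 h2 m; rewrite mcoeffM [RHS]fcoefM_split.
under eq_bigr do rewrite h1 h2.
pose E (k : bmultinom K (mdeg m).+1 * bmultinom K (mdeg m).+1) :=
  (emb (bmnm k.1), emb (bmnm k.2)).
rewrite -big_filter.
rewrite -(big_map E predT (fun p => fcoef f p.1 * fcoef g p.2)).
apply: perm_big; apply: uniq_perm.
- rewrite map_inj_uniq ?filter_uniq ?index_enum_uniq //.
  by move=> [a b] [c d] [/emb_inj/val_inj -> /emb_inj/val_inj ->].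
- exact: undup_uniq.
move=> [M M']; rewrite mem_msplit /=; apply/mapP/eqP.
  case=> [[a b]]; rewrite mem_filter /= => /andP[/eqP e _] [-> ->].
  by rewrite -embD -e.
move=> e.
have e' a : (M a + M' a)%N = emb m a by rewrite -e msetE2.
have ge0 a : (K <= a)%N -> M a = 0%N /\ M' a = 0%N.
  by move=> Ka; have /eqP := e' a; rewrite emb_ge // addn_eq0 => /andP[/eqP-> /eqP->].
pose k1 : multinom K := Multinom [tuple M (nat_of_ord i) | i < K].
pose k2 : multinom K := Multinom [tuple M' (nat_of_ord i) | i < K].
have ek : m = mnm_add k1 k2.
  by apply/mnmP => i; rewrite mnmDE !mnmE e' emb_ord.
have d1 : (mdeg k1 < (mdeg m).+1)%N by rewrite ltnS ek mdegD leq_addr.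
have d2 : (mdeg k2 < (mdeg m).+1)%N by rewrite ltnS ek mdegD leq_addl.
exists (BMultinom d1, BMultinom d2); first by rewrite mem_filter mem_index_enum /= -ek eqxx.
by rewrite /E /=; congr (_, _); apply: embP => [i|a /ge0[]] //; rewrite mnmE.
Qed.

Lemma agree_e k : agree (sym_e k) (mesym K int k).
Proof.
move=> m; rewrite mcoeff_mesym fcoef_sym_e size_emb /mechar; congr ((_ && _)%:R).
apply/forallP/idP => [h|u i]; last first.
  by rewrite -emb_ord -count_mem_mset count_uniq_mem ?leq_b1.
apply: count_mem_uniq => a; rewrite count_mem_mset.
have [e|aP] := posnP (emb m a); first by rewrite in_mset e.
have aK : (a < K)%N by rewrite ltnNge; apply/negP => /(emb_ge m) a0; rewrite a0 in aP.
have := h (Ordinal aK); rewrite -emb_ord /= => ha.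
by rewrite in_mset aP; apply/eqP; rewrite eqn_leq ha aP.
Qed.

Definition Pk (k : nat) : mpoly K int :=
  if k is j.+1 then
    if insub j is Some i then mpolyX int (mnm1 i) else 0
  else 1.

Definition Pseq (s : seq (int * seq nat)) : mpoly K int :=
  \sum_(t <- s) (\prod_(k <- t.2) Pk k) *~ t.1.

Let S := [tuple mesym K int i.+1 | i < K].

Lemma comp_Pk k : comp_mpoly S (Pk k) = mesym K int k.
Proof.
case: k => [|j] /=; first by rewrite rmorph1 mesym0E.
case: insubP => [i ji ij|]; last by rewrite -leqNgt => h; rewrite raddf0 mesym_geqnE.
by rewrite comp_mpolyXU -tnth_nth tnth_mktuple ij.
Qed.

Lemma agree_Pseq s : agree (poly_in sym_e s) (comp_mpoly S (Pseq s)).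
Proof.
rewrite /poly_in /Pseq raddf_sum; elim/big_ind2: _ => [|f p g q|t _].
- exact: agree0.
- exact: agreeD.
rewrite /= raddfMz /=; apply: agreeMz; rewrite rmorph_prod.
elim/big_ind2: _ => [|f p g q|k _]; [exact: agree1|exact: agreeM|].
by rewrite /= comp_Pk; exact: agree_e.
Qed.

Lemma mmap_Pk k : (k <= K)%N ->
  mmap (intr : int -> fps) (fun i : 'I_K => sym_h i.+1) (Pk k) = sym_h k.
Proof.
case: k => [|j] /= jK; first by rewrite rmorph1 sym_h0.
by rewrite insubT mmapX mmap1U.
Qed.

Lemma mmap_Pseq s : all (fun t => all (fun k => k <= K)%N t.2) s ->
  mmap (intr : int -> fps) (fun i : 'I_K => sym_h i.+1) (Pseq s) = poly_in sym_h s.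
Proof.
move=> /allP h; rewrite raddf_sum; apply: eq_big_seq => t /h /allP ht.
rewrite /= raddfMz /= rmorph_prod; congr (_ *~ _).
by apply: eq_big_seq => k /ht; exact: mmap_Pk.
Qed.

Lemma poly_in_wd s s' :
  all (fun t => all (fun k => k <= K)%N t.2) s ->
  all (fun t => all (fun k => k <= K)%N t.2) s' ->
  poly_in sym_e s = poly_in sym_e s' -> poly_in sym_h s = poly_in sym_h s'.
Proof.
move=> h h' e; rewrite -!mmap_Pseq //; congr mmap.
apply: msym_fundamental_un; apply/mpolyP => m.
by rewrite -/S agree_Pseq e -agree_Pseq.
Qed.

End OmegaWellDefined.

Lemma omegaE s : omega (poly_in sym_e s) = poly_in sym_h s.
Proof.
apply: xget_unique => [|g [s' e ->]]; first by exists s.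
pose K := (\max_(t <- s ++ s') \max_(k <- t.2) k)%N.
have hK : all (fun t => all (fun k => k <= K)%N t.2) (s ++ s').
  apply/allP => t ts; apply/allP => k kt.
  apply: (@leq_trans (\max_(k <- t.2) k)%N); first exact: leq_bigmax_seq.
  exact: (leq_bigmax_seq (F := fun t : int * seq nat => (\max_(k <- t.2) k)%N)).
move: hK; rewrite all_cat => /andP[h h'].
by apply: (poly_in_wd h' h).
Qed.

Lemma omega_e k : omega (sym_e k) = sym_h k.
Proof.
by have := omegaE [:: (1, [:: k])]; rewrite /poly_in; do !rewrite big_seq1 /=; rewrite !mulr1z.
Qed.

(* Main.v *)
Require Import Defs.
From mathcomp Require Import all_boot all_order all_fingroup all_algebra.
From mathcomp Require Import qpoly finmap multiset ring zify.
From mathcomp.multinomials Require Import -(notations) mpoly.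

(** Both sides satisfy the same recurrence, the left one in the [e_k] and the
    right one in the [h_k]:
      [sum_(0 <= k < n) (t^k - t) e_k W_(n-k) = (1 - t) n t^(n-1) e_n],
    i.e. [sum_n W_n z^n = (1 - t) z E'(tz) / (E(tz) - t E(z))].  By induction on
    [n], the coefficients of [W_n] are polynomials in the [e_k], and the same
    polynomials in the [h_k] give the right-hand side.

    With finitely many letters, a sum over words of a product of weights of
    cyclically adjacent letters is [tr ((D M)^(n-1) D C)], with [D] the diagonal
    matrix of the variables.  The series in [z] of these traces times
    [det (1 - z D M)] only involves the determinant and the diagonal of the
    adjugate of [1 - z D M].  They have a product formula because [M] is constant
    above the diagonal, on the diagonal and below it.

    On the right-hand side, reading [f] along [s] gives a word [w = f o s] whose
    equal adjacent letters may each be a descent or an ascent of [s],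
    independently, and this determines [s].  So the weight is [t] for [a < b], [1]
    for [a > b] and [1 + t] for [a = b] (only [t] at the closing place), except
    that on constant words one gets a correction [t^(n-1) - t^n], as the closing
    place is not a descent when all the other places are. *)

Set Implicit Arguments.
Unset Strict Implicit.
Unset Printing Implicit Defensive.
Import GRing.Theory.
Local Open Scope ring_scope.

(** * Transfer matrices *)

Section TransferMatrix.
Variables (A : comNzRingType) (K : nat).
Implicit Types (B : 'M[A]_K) (y : 'I_K -> A).

(** Bordering [B] by the row [s *: v] and the column [- u] gives a matrix with determinant
    [\det (B + u *m (s *: v))], by a Schur complement. In its expansion along the first row no
    cofactor involves [s]. *)
Lemma det_rank_one_affine B (u : 'cV[A]_K) (v : 'rV[A]_K) :
  exists c, forall s, \det (B + u *m (s *: v)) = \det B + s * c.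
Proof.
pose M s := block_mx (1%:M : 'M_1) (s *: v) (- u) B.
have detM s : \det (M s) = \det (B + u *m (s *: v)).
  have -> : M s = block_mx 1%:M 0 (- u) 1%:M *m
                  block_mx 1%:M (s *: v) 0 (B + u *m (s *: v)).
    rewrite mulmx_block !mul1mx !mul0mx !mulmx1 !addr0 mulNmx.
    by rewrite [B + _]addrC addKr.
  by rewrite det_mulmx det_lblock det_ublock !det1 !mul1r.
pose i0 := lshift K (ord0 : 'I_1).
have cofM s j : cofactor (M s) i0 j = cofactor (M 0) i0 j.
  rewrite /cofactor; congr (_ * \det _); apply/matrixP => a b.
  have : M s (lift i0 a) (lift j b) = M 0 (lift i0 a) (lift j b).
    by rewrite [lift i0 a](_ : _ = rshift 1 a) ?col_mxEd //; exact: val_inj.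
  by rewrite !mxE.
have E s : \det (M s) = cofactor (M 0) i0 i0 +
    s * \sum_j v 0 j * cofactor (M 0) i0 (rshift 1 j).
  rewrite (expand_det_row _ i0) big_split_ord big_ord1 /= block_mxEul mxE eqxx.
  rewrite mul1r cofM mulr_sumr; congr (_ + _); apply: eq_bigr => j _.
  by rewrite block_mxEur mxE cofM mulrA.
exists (\sum_j v 0 j * cofactor (M 0) i0 (rshift 1 j)) => s.
rewrite -detM E; congr (_ + _);
  rewrite -[in RHS](addr0 B) -[0 in RHS](mulmx0 _ u).
by rewrite -(scale0r v) -detM E mul0r addr0.
Qed.

Variables al be de : A.

Definition transfer_mx : 'M[A]_K :=
  \matrix_(i, j) if (i < j)%N then al else if (j < i)%N then be else de.

Definition resmx y : 'M[A]_K := \matrix_(i, j) ((i == j)%:R - y i *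
  transfer_mx i j).

(* The determinant is affine in [s] when [s] is subtracted from all the entries
   of the transfer matrix, and triangular at [s = be] and at [s = al]. *)
Lemma det_resmx y :
  (al - be) * \det (resmx y) =
  al * \prod_i (1 - (de - be) * y i) - be * \prod_i (1 - (de - al) * y i).
Proof.
have [c cP] := det_rank_one_affine (resmx y) (\col_i y i) (const_mx 1).
have E s i j : (resmx y + (\col_i y i) *m (s *: const_mx 1)) i j =
    (i == j)%:R - y i * (transfer_mx i j - s).
  by rewrite !mxE big_ord1 !mxE; ring.
have Hbe : \det (resmx y) + be * c = \prod_i (1 - (de - be) * y i).
  rewrite -cP -det_tr det_trig => [|].
    by apply: eq_bigr => i _; rewrite mxE E mxE eqxx ltnn /=; ring.
  apply/is_trig_mxP => i j ij; rewrite mxE E mxE ltnNge (ltnW ij) ij /=.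
  by rewrite -(inj_eq val_inj) gtn_eqF //=; ring.
have Hal : \det (resmx y) + al * c = \prod_i (1 - (de - al) * y i).
  rewrite -cP det_trig => [|].
    by apply: eq_bigr => i _; rewrite E mxE eqxx ltnn /=; ring.
  apply/is_trig_mxP => i j ij; rewrite E mxE ij.
  by rewrite -(inj_eq val_inj) ltn_eqF //=; ring.
by rewrite -Hbe -Hal; ring.
Qed.

(* Setting [y i] to 0 replaces row [i] of [resmx y] by a unit vector, so that
   principal minors are again determinants of the form [det_resmx]. *)
Definition vanish i y : 'I_K -> A := fun j => if j == i then 0 else y j.

Lemma adj_resmx_diag y i : (\adj (resmx y)) i i = \det (resmx (vanish i y)).
Proof.
rewrite mxE (expand_det_row _ i) (bigD1 i) //= big1 ?addr0 => [|j ji].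
  rewrite !mxE /vanish !eqxx mul0r subr0 mul1r /cofactor; congr (_ * \det _).
  by apply/matrixP => a b;
    rewrite !mxE [lift i a == i]eq_sym (negbTE (neq_lift _ _)).
by rewrite mxE /vanish eqxx eq_sym (negbTE ji) mul0r subr0 mul0r.
Qed.

Lemma prod_vanish i y (c : A) :
  \prod_j (1 - c * vanish i y j) = \prod_(j | j != i) (1 - c * y j).
Proof.
rewrite (bigD1 i) //= {1}/vanish eqxx mulr0 subr0 mul1r.
by apply: eq_bigr => j ji; rewrite /vanish (negbTE ji).
Qed.

(** The right factor is a diagonal matrix minus [resmx y], so only the determinant and the diagonal
    of the adjugate occur; [det_resmx] evaluates both. *)
Lemma tr_adj_resmx y e :
  (al - be) * \tr (\adj (resmx y) *m
                  (\matrix_(i, j) (y i * (transfer_mx i j + e *+ (i == j))))) =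
  \sum_i y i * (al * (e + de - be) * \prod_(j | j != i) (1 - (de - be) * y j)
              - be * (e + de - al) * \prod_(j | j != i) (1 - (de - al) * y j)).
Proof.
have -> : (\matrix_(i, j) (y i * (transfer_mx i j + e *+ (i == j)))) =
    diag_mx (\row_i (1 + e * y i)) - resmx y.
  apply/matrixP => i j; rewrite !mxE.
  by case: eqP => [->|_] /=; rewrite ?mulr1n ?mulr0n; ring.
rewrite mulmxBr mul_adj_mx linearB /= mxtrace_scalar.
have -> : \det (resmx y) *+ K = \sum_(i < K) \det (resmx y).
  by rewrite sumr_const card_ord.
rewrite /mxtrace -sumrB mulr_sumr; apply: eq_bigr => i _.
rewrite mxE (bigD1 i) //= big1 ?addr0 => [|j ji]; last first.
  by rewrite !mxE (negbTE ji) mulr0n mulr0.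
rewrite adj_resmx_diag !mxE eqxx mulr1n.
have := det_resmx y; have := det_resmx (vanish i y); rewrite !prod_vanish.
rewrite [\prod_j (1 - (de - be) * y j)](bigD1 i) //=.
rewrite [\prod_j (1 - (de - al) * y j)](bigD1 i) //= => H1 H2.
have -> d d' : (al - be) * (d * (1 + e * y i) - d') =
    (1 + e * y i) * ((al - be) * d) - (al - be) * d' by ring.
by rewrite H1 H2; ring.
Qed.

End TransferMatrix.

(** * Geometric series of matrices and truncated power series *)

(** The adjugate stands in for the inverse of [1%:M - M], and the last term is the truncation
    error. *)
Lemma det_geometric (A : comNzRingType) K (M B : 'M[A]_K) N :
  \det (1%:M - M) * \sum_(n < N) \tr (M ^+ n *m B) =
  \tr (\adj (1%:M - M) *m B) - \tr (\adj (1%:M - M) *m M ^+ N *m B).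
Proof.
have S : (1%:M - M) *m (\sum_(n < N) M ^+ n) = 1%:M - M ^+ N.
  elim: N => [|N IH]; first by rewrite big_ord0 mulmx0 expr0 subrr.
  by rewrite big_ord_recr mulmxDr IH /= mulmxBl mul1mx exprS addrA subrK.
rewrite -linear_sum -mulmx_suml -mxtraceZ -[X in _ = X]raddfB /= -mulmxBl.
have -> : \adj (1%:M - M) - \adj (1%:M - M) *m M ^+ N =
    \adj (1%:M - M) *m (1%:M - M ^+ N) by rewrite mulmxBr mulmx1.
by rewrite -S [X in _ = \tr (X *m _)]mulmxA mul_adj_mx mul_scalar_mx scalemxAl.
Qed.

(** The quotient by ['X^(N.+1)] serves as the ring of power series truncated after degree [N];
    identities proved there are read off coefficientwise. *)
Lemma coef_qpolyXn (A : comNzRingType) N (p q : {poly A}) :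
  in_qpoly 'X^(N.+1) p = in_qpoly 'X^(N.+1) q -> forall i, (i <= N)%N -> p`_i
    = q`_i.
Proof.
move=> e i iN; have monX : mk_monic ('X^(N.+1) : {poly A}) = 'X^(N.+1).
  by rewrite /mk_monic size_polyXn monicXn.
have red (r : {poly A}) : r`_i = (in_qpoly 'X^(N.+1) r : {poly A})`_i.
  rewrite /in_qpoly /= monX.
  rewrite [r in LHS](Pdiv.RingMonic.rdivp_eq (monicXn A N.+1) r).
  by rewrite coefD coefMXn ltnS iN add0r.
by rewrite red e -red.
Qed.

Lemma in_qpoly_Xn (A : comNzRingType) N :
  in_qpoly 'X^(N.+1) ('X^(N.+1) : {poly A}) = 0.
Proof.
apply: val_inj; rewrite /= /mk_monic size_polyXn monicXn /=.
exact: (Pdiv.RingMonic.rmodpp (monicXn A N.+1)).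
Qed.

Section Cyclic.
Variables (R : comNzRingType) (K : nat) (x : 'I_K -> R) (al be de e : R).

(* The sum over the words of length [n + 1], not [n]; [e] is added to the
   diagonal weight on the edge from the last letter to the first one. *)
Definition cyclic_sum n : R :=
  \tr ((\matrix_(i, j) (x i * transfer_mx K al be de i j)) ^+ n *m
       (\matrix_(i, j) (x i * (transfer_mx K al be de i j + e *+ (i == j))))).

Local Notation y i := ((x i)%:P * 'X).

(** This is [det_geometric] for the transfer matrix with row [i] scaled by [x i] and ['X]. By
    [det_resmx] the first factor on the left is [al - be] times the determinant, and [tr_adj_resmx]
    gives the right-hand side. *)
Lemma cyclic_sum_gf N :
  in_qpoly 'X^(N.+1)
   ((al%:P * \prod_i (1 - (de - be)%:P * y i) -
     be%:P * \prod_i (1 - (de - al)%:P * y i)) *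
    \sum_(n < N) (cyclic_sum n)%:P * 'X^(n.+1)) =
  in_qpoly 'X^(N.+1)
   (\sum_i y i * ((al * (e + de - be))%:P * \prod_(j | j != i) (1 - (de -
     be)%:P * y j)
               - (be * (e + de - al))%:P * \prod_(j | j != i) (1 - (de -
                 al)%:P * y j))).
Proof.
pose T := transfer_mx K al%:P be%:P de%:P : 'M[{poly R}]_K.
have TE i j : T i j = (transfer_mx K al be de i j)%:P by rewrite !mxE;
  do 2?case: ifP.
pose yy i : {poly R} := y i.
pose Nx := \matrix_(i, j) (x i * transfer_mx K al be de i j).
pose B := \matrix_(i, j) (yy i * (T i j + e%:P *+ (i == j))).
pose Bx := (\matrix_(i, j) (x i * (transfer_mx K al be de i j + e *+ (i ==
  j)))).
pose M := \matrix_(i, j) (yy i * T i j).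
have resE : resmx al%:P be%:P de%:P yy = 1%:M - M.
  by apply/matrixP => i j; rewrite !mxE.
have ME : M = 'X *: map_mx polyC Nx.
  apply/matrixP => i j;
    rewrite mxE TE [RHS]mxE [in RHS]mxE [Nx i j]mxE polyCM /yy.
  by rewrite mulrA [_%:P * 'X]mulrC.
have BE : B = 'X *: map_mx polyC Bx.
  apply/matrixP => i j;
    rewrite mxE TE [RHS]mxE [in RHS]mxE [Bx i j]mxE polyCM polyCD polyCMn.
  by rewrite /yy mulrA [_%:P * 'X]mulrC.
have MnE n : M ^+ n = 'X^n *: map_mx polyC (Nx ^+ n).
  elim: n => [|n IH]; first by rewrite !expr0 map_mx1 scale1r.
  have E (S : comNzRingType) (L : 'M[S]_K) : L ^+ n.+1 = L *m L ^+ n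
    by exact: exprS.
  by rewrite !E IH ME map_mxM -scalemxAl -scalemxAr scalerA -exprS.
have cycE n : (cyclic_sum n)%:P * 'X^(n.+1) = \tr (M ^+ n *m B).
  rewrite MnE BE -scalemxAl -scalemxAr scalerA mulrC -exprSr -map_mxM mxtraceZ.
  by congr (_ * _); rewrite -trace_map_mx.
have G := det_geometric M B N.
have -> : \sum_(n < N) (cyclic_sum n)%:P * 'X^(n.+1) = \sum_(n < N) \tr (M ^+
  n *m B).
  by apply: eq_bigr => n _; rewrite cycE.
rewrite !(polyCB, polyCM, polyCD) -(det_resmx _ _ _ yy) resE -mulrA G -resE.
rewrite -(tr_adj_resmx _ _ _ yy) -/B mulrBr rmorphB /= -[RHS]subr0;
  congr (_ - _).
(* [M ^+ N] and [B] together carry [N + 1] factors ['X], so the truncation error is 0 in the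
   quotient. *)
rewrite MnE BE -!(scalemxAr, scalemxAl) scalerA -exprS mxtraceZ.
by rewrite rmorphM rmorphM /= in_qpoly_Xn mul0r mulr0.
Qed.
End Cyclic.

(** * Sums over cyclic words as traces *)

Lemma sum_tupleS (R : nmodType) (T : finType) m (F : m.+1.-tuple T -> R) :
  \sum_(w : m.+1.-tuple T) F w = \sum_a \sum_(s : m.-tuple T) F [tuple of a ::
    s].
Proof.
rewrite pair_big /=.
rewrite (reindex (fun p : T * m.-tuple T => [tuple of p.1 :: p.2])) //=.
exists (fun w : m.+1.-tuple T => (thead w, [tuple of behead w])) =>
  [[a s]|w] _ /=.
  by congr (_, _); apply: val_inj.
by rewrite [w in RHS]tuple_eta.
Qed.

Section Words.
Variables (R : comNzRingType) (K : nat).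
Implicit Types (M C : 'M[R]_K).

Lemma expmx_mul_entry M C m (a b : 'I_K) :
  (M ^+ m *m C) a b =
  \sum_(s : m.-tuple 'I_K)
    (\prod_(i < m) M (nth a (a :: s) i) (nth a s i)) * C (last a s) b.
Proof.
elim: m a => [|m IH] a.
  rewrite expr0 mul1mx (big_pred1 [tuple]) => [|s]; last exact/esym/eqP/tuple0.
  by rewrite big_ord0 mul1r.
have -> : M ^+ m.+1 = M *m M ^+ m by exact: exprS.
rewrite -mulmxA mxE sum_tupleS; apply: eq_bigr => c _.
rewrite IH mulr_sumr; apply: eq_bigr => s _.
rewrite big_ord_recl /= mulrA; congr (_ * _ * _).
apply: eq_bigr => i _ /=; rewrite add0n.
by congr (M _ _); apply: set_nth_default; rewrite /= size_tuple // ltnS ltnW.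
Qed.

Lemma trace_expmx_mul M C m :
  \tr (M ^+ m *m C) =
  \sum_(w : m.+1.-tuple 'I_K)
    \prod_(i < m.+1) (if i == ord_max then C else M) (tnth w i) (tnth w (ordS
      i)).
Proof.
rewrite sum_tupleS; apply: eq_bigr => a _; rewrite expmx_mul_entry.
apply: eq_bigr => s _; rewrite big_ord_recr /= eqxx; congr (_ * _).
  apply: eq_bigr => i _; rewrite -val_eqE /= ltn_eqF //.
  rewrite !(tnth_nth a) /= modn_small ?ltnS //.
rewrite !(tnth_nth a) /= modnn /= (last_nth a) size_tuple //.
Qed.

End Words.

Section CyclicWords.
Variables (R : comNzRingType) (K : nat) (x : 'I_K -> R) (al be de e : R).

Lemma cyclic_sum_words n : cyclic_sum x al be de e n =
  \sum_(w : n.+1.-tuple 'I_K)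
    (\prod_i x (tnth w i)) *
    \prod_(i < n.+1) (transfer_mx K al be de (tnth w i) (tnth w (ordS i)) +
       e *+ ((i == ord_max) && (tnth w i == tnth w (ordS i)))).
Proof.
rewrite /cyclic_sum trace_expmx_mul; apply: eq_bigr => w _;
  rewrite -big_split /=.
by apply: eq_bigr => i _; case: eqP => _; rewrite mxE //= addr0.
Qed.
End CyclicWords.

(** * Generating functions of elementary and complete functions *)

Lemma deriv_prod (R : comNzRingType) (I : finType) (F : I -> {poly R}) :
  (\prod_i F i)^`() = \sum_i (F i)^`() * \prod_(j | j != i) F j.
Proof.
suff S r : uniq r -> (\prod_(i <- r) F i)^`() =
    \sum_(i <- r) (F i)^`() * \prod_(j <- r | j != i) F j.
  exact: S (index_enum_uniq I).
elim: r => [|a r IH]; first by rewrite !big_nil derivC.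
rewrite cons_uniq => /andP[ar ur]; rewrite !big_cons derivM IH // eqxx /=.
have neq i : i \in r -> a != i by move=> ir; apply: contraNneq ar => ->.
congr (_ * _ + _).
  rewrite big_seq [RHS]big_seq_cond; apply: eq_bigl => i.
  by case: (boolP (i \in r)) => //= /neq; rewrite eq_sym => ->.
rewrite mulr_sumr; apply: eq_big_seq => i /neq ai.
by rewrite big_cons ai mulrCA.
Qed.

Section Series.
Variables (R : comNzRingType) (K : nat).
Implicit Types x : 'I_K -> R.

Definition elem_poly x : {poly R} := \prod_i (1 + (x i)%:P * 'X).

Definition geom_poly N (a : R) : {poly R} := \poly_(k < N.+1) a ^+ k.

(** The factors are truncated separately, so only the coefficients up to degree [N] are complete
    homogeneous functions. *)
Definition complete_poly N x : {poly R} := \prod_i geom_poly N (x i).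

Lemma coef_comp_scaleX (p : {poly R}) a k : (p \Po (a *: 'X))`_k = a ^+ k *
  p`_k.
Proof.
rewrite coef_comp_poly; under eq_bigr do rewrite exprZn coefZ coefXn.
have [kp|pk] := ltnP k (size p).
  rewrite (bigD1 (Ordinal kp)) //= eqxx mulr1 mulrC big1 ?addr0 // => i ik.
  by rewrite eq_sym -[_ == _ :> nat]/(i == Ordinal kp) (negbTE ik) !mulr0.
rewrite nth_default // mulr0 big1 // => i _.
by rewrite gtn_eqF ?mulr0 // (leq_trans _ pk).
Qed.

Lemma elem_poly_scale x t k :
  (elem_poly (fun i => t * x i))`_k = t ^+ k * (elem_poly x)`_k.
Proof.
rewrite -coef_comp_scaleX rmorph_prod; congr (polyseq _)`_k;
  apply: eq_bigr => i _.
by rewrite /= comp_polyD comp_polyM !comp_polyC comp_polyX polyCM -mul_polyC;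
  ring.
Qed.

Lemma complete_poly_scale N x t k :
  (complete_poly N (fun i => t * x i))`_k = t ^+ k * (complete_poly N x)`_k.
Proof.
rewrite -coef_comp_scaleX rmorph_prod; congr (polyseq _)`_k;
  apply: eq_bigr => i _ /=.
apply/polyP => j; rewrite coef_comp_scaleX !coef_poly.
by case: ifP; rewrite ?mulr0 ?exprMn.
Qed.

(** [Pt] is [P] with its variable scaled by [t]. The recurrence is the coefficient of degree [n] of
    the product; the term [k = n] is absent because the series in [W] has no constant term. *)
Lemma series_recurrence n t (P Pt Z : {poly R}) (W : nat -> R) :
  (forall k, Pt`_k = t ^+ k * P`_k) ->
  in_qpoly 'X^(n.+1) ((Pt - t%:P * P) * \sum_(j < n) (W j.+1)%:P * 'X^(j.+1)) =
  in_qpoly 'X^(n.+1) Z ->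
  \sum_(k < n) (t ^+ k - t) * P`_k * W (n - k)%N = Z`_n.
Proof.
move=> PtE /coef_qpolyXn/(_ n (leqnn n)) <-.
have SE j : (j <= n)%N -> (\sum_(j < n) (W j.+1)%:P * 'X^(j.+1))`_j =
    if j is j'.+1 then W j else 0.
  move=> jn; rewrite coef_sum.
  under eq_bigr do rewrite coefCM coefXn.
  case: j jn => [|j] jn; first by rewrite big1 // => i _; rewrite mulr0.
  rewrite (bigD1 (Ordinal jn)) //= eqxx mulr1 big1 ?addr0 // => i ik.
  by rewrite eqSS eq_sym -[_ == _ :> nat]/(i == Ordinal jn) (negbTE ik) mulr0.
rewrite coefM big_ord_recr /= subnn (SE 0%N) // mulr0 addr0.
apply: eq_bigr => k _; rewrite SE ?leq_subr //.
rewrite coefB coefCM PtE -mulrBl.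
by have := ltn_ord k; rewrite -subn_gt0; case: (n - k)%N.
Qed.

(** These are the weights of Smirnov words; [e = 1] allows equal letters at the closing place. In
    [cyclic_sum_gf] the left factor is [E(tz) - t E(z)], and only the first product survives on the
    right. After multiplication by [t], which is cancelled by regularity, the right side is
    [(1 - t) z] times the derivative of [E(tz)]. *)
Lemma elem_recurrence x t n : GRing.lreg t -> (0 < n)%N ->
  \sum_(k < n) (t ^+ k - t) * (elem_poly x)`_k * cyclic_sum x 1 t 0 1 (n -
    k).-1 =
  (1 - t) * (t ^+ n.-1 * (elem_poly x)`_n *+ n).
Proof.
move=> t0 n0; apply: t0.
rewrite (@series_recurrence _ _ _ (elem_poly (fun i => t * x i))
  (\sum_i (x i)%:P * 'X * ((1 - t)%:P * \prod_(j | j != i) (1 + (t * x j)%:P *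
    'X)))
  (fun n => cyclic_sum x 1 t 0 1 n.-1)).
- have -> : t * (\sum_i (x i)%:P * 'X * ((1 - t)%:P * \prod_(j | j != i)
      (1 + (t * x j)%:P * 'X)))`_n =
      ((1 - t)%:P * (elem_poly (fun i => t * x i))^`() * 'X)`_n.
    rewrite -coefCM; congr (polyseq _)`_n;
      rewrite deriv_prod mulr_sumr mulr_sumr mulr_suml.
    apply: eq_bigr => i _; rewrite derivD derivC derivM derivC derivX.
    by rewrite mul0r !add0r mulr1 polyCM; ring.
  case: n n0 => // n _; rewrite coefMX /= coefCM coef_deriv elem_poly_scale.
  by rewrite exprS; ring.
- exact: elem_poly_scale.
have e := cyclic_sum_gf x 1 t 0 1 n; apply: etrans (etrans _ e) _; last first.
  congr in_qpoly; apply: eq_bigr => i _; rewrite addr0 subrr mulr0 polyC0 mul0r.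
  rewrite subr0 !mul1r; congr (_ * (_ * _)); apply: eq_bigr => j _.
  by rewrite sub0r polyCN polyCM; ring.
congr (in_qpoly _ (_ * _)); rewrite polyC1 mul1r.
congr (_ - _ * _); apply: eq_bigr => i _;
  rewrite sub0r polyCN ?polyCM ?polyC1; ring.
Qed.

Lemma geom_polyM N a :
  geom_poly N a * (1 - a%:P * 'X) = 1 - (a ^+ N.+1)%:P * 'X^(N.+1).
Proof.
rewrite /geom_poly poly_def; elim: N => [|N IH].
  by rewrite big_ord1 !expr0 alg_polyC mul1r expr1.
rewrite big_ord_recr mulrDl IH /= -mul_polyC !exprS !polyCM; ring.
Qed.

Local Notation q N := (in_qpoly 'X^(N.+1)).

(** The series [G = 1 / (1 - a z)] satisfies [G' = a G^2]. The factor ['X] makes up for the degree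
    of precision that the derivative loses under truncation. *)
Lemma deriv_geom_poly N a :
  in_qpoly 'X^(N.+1) ('X * (geom_poly N a)^`()) =
  in_qpoly 'X^(N.+1) (a%:P * 'X * geom_poly N a * geom_poly N a).
Proof.
set G := geom_poly N a.
have GM : (q N G) * q N (1 - a%:P * 'X) = 1.
  by rewrite -rmorphM geom_polyM rmorphB rmorphM /= in_qpoly_Xn mulr0 subr0
    rmorph1.
have D : 'X * G^`() * (1 - a%:P * 'X) =
    a%:P * 'X * G - (a ^+ N.+1)%:P * 'X^(N.+1) *+ N.+1.
  have := congr1 (fun p => 'X * p^`()) (geom_polyM N a).
  rewrite -/G derivM !derivB !derivM !derivC !derivX derivXn /= => e.
  rewrite -[LHS](addrK (- ('X * (G * a%:P)))).
  transitivity ('X * (G^`() * (1 - a%:P * 'X) +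
      G * (0 - (0 * 'X + a%:P * 1))) + a%:P * 'X * G); first by ring.
  rewrite e exprSr; ring.
have : q N ('X * G^`() * (1 - a%:P * 'X)) * (q N G) =
    q N (a%:P * 'X * G - (a ^+ N.+1)%:P * 'X^(N.+1) *+ N.+1) * (q N G)
      by rewrite D.
rewrite rmorphM -mulrA [X in _ * X = _]mulrC GM mulr1 => ->.
by rewrite -rmorphM mulrBl rmorphB /= mulrnAl rmorphMn !rmorphM /= in_qpoly_Xn
  mulr0 mul0r mul0rn subr0.
Qed.

(** Without the correction, [cyclic_sum_gf] gives [(H(tz) - t H(z)) T = t (1 - t) d H(z)], where [d]
    is the sum of the [t^(k-1) p_k z^k] with [p_k] the power sums. Adding the correction [(1 - t) d]
    to [T] turns the right side into [(1 - t) d H(tz)], and [t d H(tz)] is [z] times the derivative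
    of [H(tz)]. *)
Lemma complete_recurrence x t n : GRing.lreg t -> (0 < n)%N ->
  \sum_(k < n) (t ^+ k - t) * (complete_poly n x)`_k *
    (cyclic_sum x t 1 (1 + t) (-1) (n - k).-1
      + (1 - t) * (t ^+ (n - k).-1 * \sum_i x i ^+ (n - k))) =
  (1 - t) * (t ^+ n.-1 * (complete_poly n x)`_n *+ n).
Proof.
move=> t0 n0; apply: t0.
pose tx i := t * x i.
rewrite (@series_recurrence _ _ _ (complete_poly n tx)
  ((1 - t)%:P * \sum_i (x i)%:P * 'X * geom_poly n (tx i) * complete_poly n tx)
  (fun n => cyclic_sum x t 1 (1 + t) (-1) n.-1
      + (1 - t) * (t ^+ n.-1 * \sum_i x i ^+ n))).
- have /coef_qpolyXn/(_ n (leqnn n)) :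
    in_qpoly 'X^(n.+1) (t%:P * ((1 - t)%:P * \sum_i (x i)%:P * 'X *
       geom_poly n (tx i) * complete_poly n tx)) =
    in_qpoly 'X^(n.+1) ((1 - t)%:P * (complete_poly n tx)^`() * 'X).
    rewrite deriv_prod !mulr_sumr mulr_suml !rmorph_sum /=;
      apply: eq_bigr => i _.
    rewrite [_ * _ * 'X](_ : _ = (1 - t)%:P * ('X * (geom_poly n (tx i))^`()) *
      \prod_(j | j != i) geom_poly n (tx j)); last by ring.
    rewrite [RHS]in_qpolyM [in RHS]in_qpolyM deriv_geom_poly -!in_qpolyM.
    congr (q n _).
    by rewrite /complete_poly (bigD1 i) //= /tx polyCM; ring.
  rewrite coefCM => ->.
  case: n n0 => // n _; rewrite coefMX /= coefCM coef_deriv complete_poly_scale.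
  by rewrite exprS; ring.
- exact: complete_poly_scale.
have := cyclic_sum_gf x t 1 (1 + t) (-1) n.
set T := \sum_(j < n) (cyclic_sum _ _ _ _ _ j)%:P * _.
set H := complete_poly n x; set Ht := complete_poly n tx.
pose A (a : 'I_K -> R) : {poly R} := \prod_i (1 - (a i)%:P * 'X).
pose s := \sum_i (x i)%:P * 'X * \prod_(j | j != i) (1 - (tx j)%:P * 'X).
pose d := \sum_i (x i)%:P * 'X * geom_poly n (tx i).
have GM a : q n (geom_poly n a) * q n (1 - a%:P * 'X) = 1.
  by rewrite -in_qpolyM geom_polyM rmorphB /= in_qpolyM in_qpoly_Xn mulr0
    subr0 rmorph1.
have HA a : q n (complete_poly n a) * q n (A a) = 1.
  by rewrite !rmorph_prod -big_split big1 // => i _; exact: GM.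
have sHt : (q n s) * (q n Ht) = (q n d).
  rewrite !rmorph_sum mulr_suml; apply: eq_bigr => i _.
  rewrite [X in X * _]in_qpolyM [RHS]in_qpolyM -mulrA; congr (_ * _).
  have -> : Ht = geom_poly n (tx i) * \prod_(j | j != i) geom_poly n (tx j).
    by rewrite /Ht /complete_poly (bigD1 i).
  rewrite in_qpolyM mulrCA !rmorph_prod -big_split.
  by rewrite big1 ?mulr1 // => j _; rewrite [LHS]mulrC; exact: GM.
have -> : q n ((t%:P * \prod_i (1 - (1 + t - 1)%:P * ((x i)%:P * 'X)) -
     1%:P * \prod_i (1 - (1 + t - t)%:P * ((x i)%:P * 'X))) * T) =
     q n ((t%:P * A tx - A x) * T).
  rewrite polyC1 mul1r addrAC subrr add0r addrK polyC1;
    congr (q n ((_ * _ - _) * _)).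
    by apply: eq_bigr => i _; rewrite /tx polyCM; ring.
  by apply: eq_bigr => i _; rewrite mul1r.
have -> : \sum_i (x i)%:P * 'X * ((t * (-1 + (1 + t) - 1))%:P *
     \prod_(j | j != i) (1 - (1 + t - 1)%:P * ((x j)%:P * 'X)) -
     (1 * (-1 + (1 + t) - t))%:P *
     \prod_(j | j != i) (1 - (1 + t - t)%:P * ((x j)%:P * 'X))) =
     t%:P * (t - 1)%:P * s.
  rewrite mulr_sumr; apply: eq_bigr => i _.
  rewrite [X in (1 * X)%:P](_ : _ = 0); last by ring.
  rewrite [X in (t * X)%:P](_ : _ = t - 1); last by ring.
  rewrite mulr0 polyC0 mul0r subr0 polyCM mulrCA; congr (_ * (_ * _)).
  by apply: eq_bigr => j _; rewrite addrAC subrr add0r /tx polyCM mulrA.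
move=> F1.
have cd : q n (\sum_(j < n) (t ^+ j * \sum_i x i ^+ j.+1)%:P * 'X^(j.+1)) = (q
  n d).
  rewrite /d /geom_poly.
  have -> : \sum_i (x i)%:P * 'X * \poly_(k < n.+1) tx i ^+ k =
     \sum_(j < n.+1) (t ^+ j * \sum_i x i ^+ j.+1)%:P * 'X^(j.+1).
    under eq_bigr do rewrite poly_def mulr_sumr.
    rewrite exchange_big; apply: eq_bigr => j _ /=.
    rewrite mulr_sumr rmorph_sum mulr_suml; apply: eq_bigr => i _.
    by rewrite /tx exprMn -mul_polyC !exprS !polyCM; ring.
  by rewrite big_ord_recr in_qpolyD [in RHS]in_qpolyM in_qpoly_Xn mulr0 addr0.
have -> : \sum_(j < n) (cyclic_sum x t 1 (1 + t) (-1) j.+1.-1 +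
     (1 - t) * (t ^+ j.+1.-1 * \sum_i x i ^+ j.+1))%:P * 'X^(j.+1) =
   T + (1 - t)%:P * \sum_(j < n) (t ^+ j * \sum_i x i ^+ j.+1)%:P * 'X^(j.+1).
  rewrite /T mulr_sumr -big_split; apply: eq_bigr => j _ /=.
  by rewrite polyCD [(_ * (_ * _))%:P]polyCM; ring.
have -> : \sum_i (x i)%:P * 'X * geom_poly n (tx i) * Ht = d * Ht.
  by rewrite mulr_suml.
move: F1 (HA tx) (HA x); rewrite -/H -/Ht !polyCB !polyC1.
have qN p : q n (- p) = - q n p by exact: rmorphN.
rewrite !(in_qpolyM, in_qpolyD, qN, in_qpoly1) cd -sHt.
set a := (q n Ht); set b := (q n H); set u := (q n t%:P) => F1 aA bA.
(* Both sides are multiplied by [a] and [b], the inverses in the quotient of the two products. *)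
have {}F1 : (a - u * b) * (q n T) = u * (1 - u) * ((q n s) * a) * b.
  transitivity (- ((u * q n (A tx) - q n (A x)) * (q n T) * a * b)); last first.
    by rewrite F1; ring.
  transitivity (- ((u * (a * q n (A tx)) * b - a * (b * q n (A x))) * (q n
    T))); last by ring.
  by rewrite aA bA; ring.
by rewrite mulrDr F1; ring.
Qed.

End Series.

Section SeriesMorphism.
Variables (R S : comNzRingType) (f : {rmorphism R -> S}) (K : nat) (x : 'I_K
  -> R).

Lemma elem_poly_morph k :
  (elem_poly (fun i => f (x i)))`_k = f (elem_poly x)`_k.
Proof.
rewrite -coef_map rmorph_prod; congr (polyseq _)`_k; apply: eq_bigr => i _.
by rewrite rmorphD rmorph1 rmorphM /= map_polyC map_polyX.
Qed.

Lemma complete_poly_morph N k :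
  (complete_poly N (fun i => f (x i)))`_k = f (complete_poly N x)`_k.
Proof.
rewrite -coef_map rmorph_prod; congr (polyseq _)`_k; apply: eq_bigr => i _ /=.
apply/polyP => j; rewrite coef_map !coef_poly.
case: ifP => _; [exact/esym/rmorphXn|exact/esym/raddf0].
Qed.

End SeriesMorphism.

(** * Permutations compatible with a word *)

Lemma perm_rank n (s : 'S_n) i : #|[set j | (s j < s i)%N]| = s i.
Proof.
have -> : [set j | (s j < s i)%N] = s @^-1: [set k : 'I_n | (k < s i)%N].
  by apply/setP => j; rewrite !inE.
rewrite card_preimset; last exact: perm_inj.
rewrite cardsE cardE -(size_map val) -[RHS](size_iota 0);
  apply/perm_size/uniq_perm.
- by rewrite (map_inj_uniq val_inj) enum_uniq.
- exact: iota_uniq.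
move=> k; rewrite mem_iota add0n /=; apply/mapP/idP => [[j]|ks].
  by rewrite mem_enum => js ->.
by exists (Ordinal (ltn_trans ks (ltn_ord _))) => //; rewrite mem_enum.
Qed.

Lemma perm_lt_inj n (s s' : 'S_n) :
  (forall i j, (s i < s j)%N = (s' i < s' j)%N) -> s = s'.
Proof.
move=> e; apply/permP => i; apply: val_inj;
  rewrite /= -(perm_rank s) -(perm_rank s').
by congr #|pred_of_set _|; apply/setP => j; rewrite !inE e.
Qed.

Section CompatiblePermutations.
Variables (m : nat) (w : 'I_m.+1 -> nat).
Implicit Types (s : 'S_m.+1) (D : {set 'I_m.+1}).

(** The letters of [w], listed by increasing value of [s], form a function counted by [fundF] for
    the set [DESge2] of the inverse of [s]; see [fundF_compatible]. *)
Definition compatible s :=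
  [forall p, forall q, (s q == (s p).+1 :> nat) ==>
     ((w q <= w p) && ((q.+2 <= p) ==> (w q < w p)))%N].

Definition plateaus : {set 'I_m.+1} :=
  [set i : 'I_m.+1 | (i < m)%N && (w i == w (ordS i))].

Definition plateau_descents s : {set 'I_m.+1} :=
  [set i in plateaus | (s (ordS i) < s i)%N].

(* The first position of the maximal run of descents in [D] containing [k]. *)
Fixpoint block D k : nat :=
  if k is k'.+1 then if inord k' \in D then block D k' else k else 0.

(* A permutation compatible with [w] and with plateau descents [D] lists the
   positions by decreasing letter, then by run of descents from left to right,
   and from right to left inside a run. *)
Definition before D (p q : 'I_m.+1) : bool :=
  ((w q < w p) || (w p == w q) &&
    ((block D p < block D q) || (block D p == block D q) && (q < p)))%N.

Lemma block_le D k : (block D k <= k)%N.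
Proof. by elim: k => //= k IH; case: ifP => _ //; apply: leqW. Qed.

Lemma block_mono D k l : (k <= l)%N -> (block D k <= block D l)%N.
Proof.
elim: l => [|l IH]; first by rewrite leqn0 => /eqP ->.
rewrite leq_eqVlt => /predU1P[->//|/IH kl]; apply: leq_trans kl _ => /=.
by case: ifP => // _; apply/leqW/block_le.
Qed.

Lemma block_eq D k l j : block D k = block D l -> (k <= j < l)%N -> inord j
  \in D.
Proof.
move=> e /andP[kj jl]; apply: contraT => jD.
have := block_mono D jl; rewrite /= (negbTE jD) -e leqNgt.
by rewrite (leq_ltn_trans (block_le D k)) ?ltnS.
Qed.

Lemma before_trans D p q r : before D p q -> before D q r -> before D p r.
Proof. rewrite /before; lia. Qed.

Lemma before_irr D p : before D p p = false.
Proof. rewrite /before; lia. Qed.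

Lemma before_total D p q : p != q -> before D p q || before D q p.
Proof. rewrite -val_eqE /before /=; lia. Qed.

Lemma ordS_inord k : (k < m)%N -> ordS (inord k : 'I_m.+1) = inord k.+1.
Proof.
move=> km; apply: val_inj; rewrite /= !inordK ?ltnS //; last exact: ltnW.
by rewrite modn_small.
Qed.

(** By transitivity it suffices to treat consecutive values. If their letters are equal,
    compatibility leaves [p' < q'] or [p' = q' + 1]. In the second case [q'] is a plateau descent,
    so both lie in one run; in the first, a common run would force [s q' <= s p']. *)
Lemma compatible_lt s p q : compatible s ->
  (s p < s q)%N = before (plateau_descents s) p q.
Proof.
move=> cs; set D := plateau_descents s.
have step p' q' : s q' = (s p').+1 :> nat -> before D p' q'.
  move=> e; have /forallP/(_ p')/forallP/(_ q') := cs.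
  rewrite e eqxx /= => /andP[wqp far]; rewrite /before.
  have [//|wpq] := ltnP (w q') (w p').
  have we : w p' = w q' by apply/eqP; rewrite eqn_leq wpq.
  have qp : (p' < q'.+2)%N by rewrite ltnNge; apply: contraL far => ->;
    rewrite we ltnn.
  rewrite we eqxx /=.
  have [pq|qp'|/val_inj epq] := ltngtP p' q'; last by rewrite epq in e; lia.
    rewrite ltn_neqAle (block_mono D (ltnW pq)) andbT andbF orbF;
      apply/eqP => eb.
    have desc j : (p' <= j <= q')%N -> (s (inord j) <= s p')%N.
      elim: j => [|j IH] /andP[pj jq].
        by move: pj; rewrite leqn0 => /eqP p0; rewrite -p0 inord_val.
      have [pj'|jp] := leqP p' j; last first.
        by rewrite (_ : j.+1 = p') ?inord_val //; lia.
      apply: leq_trans (IH _); last lia.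
      have := block_eq eb (j := j); rewrite pj' jq => /(_ isT).
      have jm : (j < m)%N by have := ltn_ord q'; lia.
      by rewrite !inE ordS_inord // => /andP[_]; exact: ltnW.
    by have := desc q'; rewrite inord_val (ltnW pq) leqnn e ltnn => /(_ isT).
  have ep : p' = q'.+1 :> nat by lia.
  have qm : (q' < m)%N by rewrite -ltnS -ep.
  have oS : ordS q' = p' by apply: val_inj; rewrite /= ep modn_small.
  have qD : q' \in D by rewrite !inE qm oS we eqxx e ltnSn.
  by rewrite ep /= inord_val qD ltnn eqxx /=.
have imp d p' q' : (s q' = s p' + d.+1 :> nat)%N -> before D p' q'.
  elim: d p' q' => [|d IH] p' q'; first by rewrite addn1; exact: step.
  move=> e; have lt : (s p' + d.+1 < m.+1)%N by have := ltn_ord (s q'); lia.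
  apply: (@before_trans D _ (s^-1%g (Ordinal lt))).
    by apply: IH; rewrite permKV.
  by apply: step; rewrite permKV /= e addnS.
have imp' p' q' : (s p' < s q')%N -> before D p' q'.
  by move=> lt; apply: (imp (s q' - s p').-1); lia.
apply/idP/idP => [/imp'//|bpq]; rewrite ltnNge; apply/negP.
rewrite leq_eqVlt => /predU1P[/val_inj/perm_inj e|/imp' bqp].
  by rewrite e before_irr in bpq.
by have := before_trans bpq bqp; rewrite before_irr.
Qed.

Lemma compatible_inj s s' : compatible s -> compatible s' ->
  plateau_descents s = plateau_descents s' -> s = s'.
Proof.
by move=> cs cs' e; apply: perm_lt_inj => i j; rewrite !compatible_lt // e.
Qed.

(** The permutation sends a position to its rank for the order [before D]. *)
Lemma compatible_exists D : D \subset plateaus ->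
  exists2 s, compatible s & plateau_descents s = D.
Proof.
move=> /subsetP DE.
pose f p := #|[set q | before D q p]|.
have f_lt p q : before D p q -> (f p < f q)%N.
  move=> bpq; apply: proper_card; apply/properP; split.
    by apply/subsetP => r; rewrite !inE => /before_trans; apply.
  by exists p; rewrite inE // before_irr.
have f_bd p : (f p < m.+1)%N.
  rewrite -[X in (_ < X)%N](card_ord m.+1) -cardsT; apply: proper_card.
  by apply/properP; split; [exact: subsetT|exists p; rewrite !inE ?before_irr].
have f_inj : injective (fun p => Ordinal (f_bd p)).
  move=> p q [e]; apply: contraTeq isT => /(before_total D)/orP[] /f_lt;
    by rewrite e ltnn.
have sE p q : (perm f_inj p < perm f_inj q)%N = before D p q.
  rewrite !permE /=; apply/idP/idP => [lt|/f_lt//].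
  have [e|/(before_total D)/orP[//|/f_lt]] := eqVneq p q.
    by rewrite e ltnn in lt.
  by rewrite ltnNge (ltnW lt).
exists (perm f_inj).
  apply/forallP => p; apply/forallP => q; apply/implyP => /eqP e.
  have bpq : before D p q by rewrite -sE e.
  have wqp : (w q <= w p)%N by move: bpq; rewrite /before; lia.
  rewrite wqp; apply/implyP => qp; rewrite ltn_neqAle wqp andbT;
    apply/eqP => ew.
  have bl := block_mono D (leq_trans (leqnSn _) (ltnW qp)).
  have eb : block D q = block D p.
    by move: bpq bl; rewrite /before; lia.
  have qD : q \in D by have := block_eq eb (j := q); rewrite leqnn inord_val;
    apply; lia.
  have := DE _ qD; rewrite inE => /andP[qm /eqP wq].
  have oq : ordS q = q.+1 :> nat by rewrite /= modn_small.
  (* The position after [q], in the same run, would have a rank strictly between the consecutive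
     ranks of [p] and [q]. *)
  have b1 : before D p (ordS q).
    by rewrite /before -wq ew eqxx oq /= inord_val qD eb eqxx qp orbT orbT.
  have b2 : before D (ordS q) q.
    by rewrite /before -wq eqxx oq /= inord_val qD eqxx ltnSn !orbT.
  by move: b2; rewrite -!sE e ltnS leqNgt sE b1.
apply/setP => i; rewrite !inE sE; apply/idP/idP; last first.
  move=> iD; have := DE _ iD; rewrite inE => /andP[im /eqP wi].
  rewrite im wi eqxx /before wi eqxx /= modn_small //= inord_val iD.
  by rewrite eqxx ltnSn !orbT.
case/andP=> /andP[im /eqP wi]; rewrite /before -wi eqxx ltnn /= modn_small //=.
rewrite inord_val; case: ifP => // _; have := block_le D i; lia.
Qed.

End CompatiblePermutations.

(** * Cyclic descents of compatible permutations *)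

Lemma expr_cdes (R : comNzRingType) (t : R) n (w : n.-tuple nat) :
  t ^+ cdes w = \prod_i t ^+ (tnth w (ordS i) < tnth w i)%N.
Proof.
rewrite prodrXr /cdes -sum1_card big_mkcond /=; congr (_ ^+ _).
Qed.

Section CyclicDescentSum.
Variables (m : nat) (w : 'I_m.+1 -> nat) (R : comNzRingType) (t : R).
Implicit Types (s : 'S_m.+1) (D : {set 'I_m.+1}).

Let interior : {set 'I_m.+1} := [set i : 'I_m.+1 | (i < m)%N].

Lemma interior_plateaus :
  (interior \subset plateaus w) = [forall i, w i == w ord0].
Proof.
apply/subsetP/forallP => [h i|h i]; last first.
  by rewrite !inE => ->; rewrite (eqP (h i)) (eqP (h (ordS i))) /=.
have H k : (k <= m)%N -> w (inord k) = w ord0.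
  elim: k => [|k IH] km; first by congr w; apply: val_inj; rewrite /= inordK.
  rewrite -IH; last exact: ltnW.
  have := h (inord k); rewrite !inE inordK ?ltnS ?(ltnW km) //.
  by move=> /(_ km) /andP[_ /eqP ->]; rewrite ordS_inord.
by rewrite -[i in X in X == _]inord_val H // -ltnS.
Qed.

(** [F] and [G] weigh a place inside and outside the set of plateau descents. Larger letters have
    smaller values under a compatible [s], so an ascent of [w] is a descent of [s]. *)
Let F (i : 'I_m.+1) : R := if i \in plateaus w then t else 0.
Let G (i : 'I_m.+1) : R :=
  if (w i < w (ordS i))%N then t
  else if (w i == w (ordS i)) && (i == ord_max) then t else 1.

Lemma ordS_max : ordS (ord_max : 'I_m.+1) = ord0.
Proof. by apply: val_inj; rewrite /= modnn. Qed.

(** If the first and last letters are equal, the closing place is a descent unless both positions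
    lie in one run, i.e. [D] is all of [interior]. In that case the product is [t^(m+1)] while the
    true weight is [t^m]. *)
Lemma compatible_cdes s : compatible w s ->
  let D := plateau_descents w s in
  t ^+ cdes (perm_word s) =
  \prod_i (if i \in D then F i else G i) + (t ^+ m - t ^+ m.+1) *+ (D ==
    interior).
Proof.
move=> cs D.
have DE : D \subset plateaus w by apply/subsetP => i; rewrite inE => /andP[].
have max_nD : ord_max \notin D by rewrite !inE ltnn.
have neq_max i : (i != ord_max :> 'I_m.+1) = (i < m)%N.
  by rewrite -val_eqE /= ltn_neqAle -ltnS ltn_ord andbT.
have int i : i != ord_max -> t ^+ (s (ordS i) < s i)%N = if i \in D then F i
  else G i.
  rewrite neq_max => im;
    rewrite !inE /F /G !inE im -[i == ord_max]negbK neq_max im andbF /=.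
  case: (ltngtP (w i) (w (ordS i))) => h /=.
  - by rewrite (compatible_lt _ _ cs) /before h.
  - by rewrite (compatible_lt _ _ cs) /before ltnNge (ltnW h) ltn_eqF.
  - by case: ifP.
rewrite expr_cdes; under eq_bigr do rewrite !tnth_mktuple.
rewrite [LHS](bigD1 ord_max) // [X in X + _](bigD1 ord_max) //= (negbTE
  max_nD) -(eq_bigr _ int).
rewrite ordS_max (compatible_lt _ _ cs) -/D /before /G ordS_max eqxx andbT /=
  ltn0 andbF orbF.
have D_lt i : i \in D -> (i < m)%N by rewrite !inE => /andP[/andP[]].
have [Dint|Dint] := eqVneq D interior; last first.
  have bm : (0 < block D m)%N.
    rewrite lt0n; apply: contra_neq Dint => b0; apply/eqP; rewrite eqEsubset.
    apply/andP; split; apply/subsetP => i;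
      first by rewrite [_ \in interior]inE => /D_lt.
    rewrite inE => im; have := @block_eq _ D 0 m i; rewrite b0 inord_val; exact.
  rewrite addr0 bm andbT; congr (_ * _); rewrite [w ord_max == _]eq_sym.
  by case: ltngtP.
have /forallP/(_ ord_max)/eqP wm : [forall i, w i == w ord0].
  by rewrite -interior_plateaus -Dint.
have b0 k : (k <= m)%N -> block D k = 0%N.
  elim: k => //= k IH km; rewrite Dint inE inordK ?ltnS ?(ltnW km) // km -Dint.
  by rewrite IH // ltnW.
rewrite wm ltnn eqxx b0 // ltnn expr0 mul1r.
rewrite (eq_bigr (fun=> t)) => [|i im]; last first.
  rewrite int // Dint inE -neq_max im /F; move/subsetP: DE => -> //.
  by rewrite Dint inE -neq_max.
by rewrite prodr_const cardC1 card_ord exprS addrC subrK.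
Qed.

(** Compatible permutations correspond to subsets of [plateaus], so each plateau chooses
    independently between [F] and [G] and the sum factors. The correction occurs when [interior] is
    one of these subsets, i.e. when [w] is constant. *)
Lemma sum_compatible :
  \sum_(s | compatible w s) t ^+ cdes (perm_word s) =
  \prod_i ((if (w i < w (ordS i))%N then t
            else if (w (ordS i) < w i)%N then 1 else 1 + t)
           + (-1) *+ ((i == ord_max) && (w i == w (ordS i))))
  + (t ^+ m - t ^+ m.+1) *+ [forall i, w i == w ord0].
Proof.
pose inv D := odflt 1%g [pick s | compatible w s & plateau_descents w s == D].
have invK s : compatible w s -> inv (plateau_descents w s) = s.
  rewrite /inv => cs; case: pickP => [s' /andP[cs' /eqP e]|/(_ s)] /=.
    exact: compatible_inj e.
  by rewrite cs eqxx.
rewrite (reindex_onto inv (plateau_descents w)) //=.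
transitivity (\sum_(D : {set _} | D \subset plateaus w)
   (\prod_i (if i \in D then F i else G i) + (t ^+ m - t ^+ m.+1) *+ (D ==
     interior))).
  apply: eq_big => [D|D /andP[cs /eqP e]]; last first.
    by rewrite compatible_cdes // e.
  apply/andP/idP => [[_ /eqP <-]|/compatible_exists[s cs <-]];
    last by rewrite invK.
  by apply/subsetP => i; rewrite inE => /andP[].
rewrite big_split /=; congr (_ + _); last first.
  rewrite -interior_plateaus big_mkcond (bigD1 interior) //= eqxx.
  by rewrite big1 => [|D /negbTE ->]; [case: (_ \subset _);
    rewrite addr0|case: ifP].
transitivity (\prod_i (F i + G i)).
  rewrite bigA_distr [RHS](bigID [pred D : {set _} | D \subset plateaus w]) /=.
  rewrite [X in _ + X]big1 ?addr0 // => D /subsetPn[i iD iP].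
  by rewrite (bigD1 i) //= iD /F (negbTE iP) mul0r.
apply: eq_bigr => i _; rewrite /F /G inE.
have -> : (i < m)%N = (i != ord_max).
  by rewrite -val_eqE /= ltn_neqAle -ltnS ltn_ord andbT.
case: (ltngtP (w i) (w (ordS i))) => /= _; case: (i == ord_max) => /=; ring.
Qed.

End CyclicDescentSum.

(** * Reduction to finitely many variables *)

Lemma fcoef_sym_h k m : fcoef (sym_h k) m = (size (enum_mset m) == k)%:R.
Proof.
pose s := sort leq (enum_mset m).
pose r : seq (k.-tuple nat) := pmap insub [:: s].
rewrite (fcoef_formal_sum (r := r)).
- rewrite /r /=; case: insubP => [w|]; rewrite size_sort;
  [by move=> ->|by move/negbTE => ->].
- exact: pmap_sub_uniq.
- move=> w; rewrite /= word_mon_eq mem_pmap_sub inE; split=> [/eqP e|[sw pw]].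
    by rewrite -[tval w]/(val w) e sort_sorted ?perm_sort //; exact: leq_total.
  apply/eqP/(sorted_eq leq_trans anti_leq) => //.
    exact/sort_sorted/leq_total.
  by rewrite perm_sym perm_sort perm_sym.
Qed.

Section Agreement.
Variable K : nat.
Local Notation X i := (mpolyX int (mnm1 (i : 'I_K))).

Lemma mcoeff_word n (w : n.-tuple 'I_K) m :
  mcoeff m (\prod_i X (tnth w i)) = (word_mon (map_tuple val w) == emb m)%:R.
Proof.
have -> : word_mon (map_tuple val w) = emb (\big[@mnm_add K/@mnm0 K]_i mnm1
  (tnth w i)).
  apply: embP => [i|a Ka]; rewrite mset_seqE count_map; last first.
    apply/eqP; rewrite -leqn0 leqNgt -has_count;
      apply/hasP => -[j _ /eqP /= ja].
    by have := ltn_ord j; rewrite ja ltnNge Ka.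
  rewrite mnm_sumE -sum1_count big_mkcond big_tuple; apply: eq_bigr => j _.
  by rewrite mnm1E /= -val_eqE; case: eqP.
by rewrite (inj_eq (@emb_inj K)) mprodXE mcoeffX.
Qed.

(** A word whose monomial is [emb m] has all its letters below [K], so words over ['I_K] account for
    the whole coefficient. *)
Lemma agree_formal_sum n (A : n.-tuple nat -> Prop) (B : pred (n.-tuple 'I_K)) :
  (forall w, A (map_tuple val w) <-> B w) ->
  agree (formal_sum A (@word_mon n)) (\sum_(w | B w) \prod_i X (tnth w i)).
Proof.
move=> AB m; rewrite [LHS]raddf_sum.
under eq_bigr do rewrite /= mcoeff_word.
pose r := [seq map_tuple val w | w <- [seq w <- enum {: n.-tuple 'I_K} |
             B w && (word_mon (map_tuple val w) == emb m)]].
rewrite (fcoef_formal_sum (r := r)).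
- by rewrite size_map size_filter -sum1_count natr_sum big_enum_cond /=
  big_mkcondr
    /= [RHS]big_mkcond [LHS]big_mkcond; apply: eq_bigr => w _; do 2?case: ifP.
- rewrite map_inj_uniq; first exact/filter_uniq/enum_uniq.
  by move=> w w' /(congr1 val)/(inj_map val_inj)/val_inj.
move=> w; split=> [/mapP[w']|[Aw e]].
  by rewrite mem_filter => /andP[/andP[Bw /eqP ew] _] ->; split=> //; apply/AB.
have letters a : a \in w -> (a < K)%N.
  move=> aw; rewrite ltnNge; apply/negP => /(emb_ge m); rewrite -e mset_seqE.
  by move/eqP; rewrite -leqn0 leqNgt -has_count has_pred1 aw.
have [w' ww'] : exists w' : n.-tuple 'I_K, w = map_tuple val w'.
  exists [tuple Ordinal (letters _ (mem_tnth i w)) | i < n].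
  by apply: eq_from_tnth => i; rewrite tnth_map tnth_mktuple.
apply/mapP; exists w' => //;
  rewrite mem_filter mem_enum andbT -ww' e eqxx andbT.
by apply/AB; rewrite -ww'.
Qed.

Lemma agree_elem k : agree (sym_e k) (elem_poly (fun i => X i))`_k.
Proof.
suff -> : (elem_poly (fun i => X i))`_k = mesym K int k by exact: agree_e.
rewrite /elem_poly; under eq_bigr do rewrite addrC.
rewrite bigA_distr coef_sum /mesym [RHS]big_mkcond.
apply: eq_bigr => h _; rewrite -big_mkcond /= big_split /= prodr_const.
by rewrite -rmorph_prod coefCM coefXn eq_sym; case: eqP; rewrite ?mulr1 ?mulr0.
Qed.

(** In degree [k <= N] no exponent exceeds [N], so each monomial arises from exactly one choice of
    terms in the truncated factors. *)
Lemma agree_complete N k : (k <= N)%N ->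
  agree (sym_h k) (complete_poly N (fun i => X i))`_k.
Proof.
move=> kN m; rewrite fcoef_sym_h size_emb /complete_poly /geom_poly.
under eq_bigr do rewrite poly_def.
rewrite bigA_distr_bigA coef_sum raddf_sum /=.
pose mn (f : {ffun 'I_K -> 'I_N.+1}) : multinom K := Multinom [tuple (f i :
  nat) | i < K].
have mnP f i : mn f i = f i by rewrite mnmE.
transitivity (\sum_f (if (mdeg m == k) && (mn f == m) then 1 else 0 : int)).
  apply: eq_bigr => f _; rewrite scaler_prod -expr_sum coefZ coefXn.
  have -> : \prod_i X i ^+ f i = mpolyX int (mn f).
    by rewrite mpolyXE_id; apply: eq_bigr => i _; rewrite mnP.
  rewrite mulr_natr raddfMn /= mcoeffX.
  have -> : (\sum_i (f i : nat))%N = mdeg (mn f).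
    by rewrite mdegE; apply: eq_bigr => i _; rewrite mnP.
  case: (eqVneq (mn f) m) => [->|_]; rewrite ?andbT ?andbF ?mul0rn //.
  by rewrite eq_sym; case: eqP.
case: (eqVneq (mdeg m) k) => [mk|_] /=; last first.
  by rewrite big1.
have mN i : (m i < N.+1)%N.
  rewrite ltnS (leq_trans _ kN) // -mk mdegE (bigD1 i) //=; exact: leq_addr.
pose f0 : {ffun 'I_K -> 'I_N.+1} := [ffun i => Ordinal (mN i)].
rewrite (bigD1 f0) //= big1 ?addr0 => [|f ff0].
  by rewrite (_ : mn f0 = m) ?eqxx //; apply/mnmP => i; rewrite mnP ffunE.
case: eqP => // e; case/eqP: ff0; apply/ffunP => i; apply: val_inj.
by rewrite ffunE /= -e mnP.
Qed.

Definition poly_agree (P : {poly fps}) (p : {poly mpoly K int}) :=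
  forall j, agree P`_j p`_j.

Lemma poly_agreeD P Q p q :
  poly_agree P p -> poly_agree Q q -> poly_agree (P + Q) (p + q).
Proof. by move=> hp hq j; rewrite !coefD; apply: agreeD. Qed.

Lemma poly_agreeB P Q p q :
  poly_agree P p -> poly_agree Q q -> poly_agree (P - Q) (p - q).
Proof. by move=> hp hq j; rewrite !coefB; apply: agreeD => //;
  apply: agreeN. Qed.

Lemma poly_agree_sum (I : Type) (r : seq I) (B : pred I) P p :
  (forall i, B i -> poly_agree (P i) (p i)) ->
  poly_agree (\sum_(i <- r | B i) P i) (\sum_(i <- r | B i) p i).
Proof.
move=> h; elim/big_ind2: _ => [j|? ? ? ?|//]; last exact: poly_agreeD.
by rewrite !coef0; exact: agree0.
Qed.

Lemma poly_agreeM P Q p q :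
  poly_agree P p -> poly_agree Q q -> poly_agree (P * Q) (p * q).
Proof.
move=> hp hq j; rewrite !coefM; elim/big_ind2: _ => [|? ? ? ?|i _].
- exact: agree0.
- exact: agreeD.
- exact: agreeM.
Qed.

Lemma poly_agreeC f p : agree f p -> poly_agree f%:P p%:P.
Proof. by move=> h j; rewrite !coefC; case: eqP => _ //; exact: agree0. Qed.

Lemma poly_agreeXn n : poly_agree 'X^n 'X^n.
Proof. by move=> j; rewrite !coefXn; apply: agreeMn; exact: agree1. Qed.

Lemma poly_agreeX : poly_agree 'X 'X.
Proof. by rewrite -['X](expr1 'X); apply: poly_agreeXn. Qed.

Lemma poly_agree1 : poly_agree 1 1.
Proof. by rewrite -(expr0 'X); apply: (poly_agreeXn 0). Qed.

Lemma poly_agreeMn n P p : poly_agree P p -> poly_agree (P *+ n) (p *+ n).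
Proof. by move=> h j; rewrite !coefMn; apply: agreeMn. Qed.

End Agreement.

(** A monomial involves finitely many variables, so [K] can be taken above all their indices. *)
Lemma poly_agree_inj (P Q : {poly fps}) :
  (forall K, exists2 p : {poly mpoly K int}, poly_agree P p & poly_agree Q p)
    -> P = Q.
Proof.
move=> h; apply/polyP => j; apply: fpsP => M.
pose K := (\max_(a <- enum_mset M) a).+1.
have [p /(_ j) hP /(_ j) hQ] := h K.
pose m : multinom K := Multinom [tuple M (nat_of_ord i) | i < K].
have -> : M = emb m.
  apply: embP => [i|a Ka]; first by rewrite mnmE.
  apply/eqP; rewrite -leqn0 leqNgt -in_mset; apply/negP => aM.
  have := @leq_bigmax_seq _ (enum_mset M) predT id a aM isT.
  by rewrite leqNgt Ka.
by rewrite -hP -hQ.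
Qed.

(** * Both sides as cyclic sums over finitely many letters *)

Section Transfer.
Variable K : nat.
Local Notation X i := (mpolyX int (mnm1 (i : 'I_K))).
Local Notation x := (fun i : 'I_K => (X i)%:P : {poly mpoly K int}).

Lemma poly_agree_elem k : poly_agree (sym_e k)%:P (elem_poly x)`_k.
Proof.
by rewrite (elem_poly_morph polyC); apply: poly_agreeC; exact: agree_elem.
Qed.

Lemma poly_agree_complete N k : (k <= N)%N ->
  poly_agree (sym_h k)%:P (complete_poly N x)`_k.
Proof.
move=> kN.
by rewrite (complete_poly_morph polyC); apply: poly_agreeC;
  exact: agree_complete.
Qed.

Lemma smirnov_ord m (w : m.+1.-tuple nat) :
  smirnov w = [forall i : 'I_m.+1, (i != ord_max) ==> (tnth w i != tnth w
    (ordS i))].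
Proof.
have neq_max (i : 'I_m.+1) : (i != ord_max) = (i < m)%N.
  by rewrite -val_eqE /= ltn_neqAle -ltnS ltn_ord andbT.
apply/(sortedP 0%N)/forallP => [h i|h i].
  apply/implyP; rewrite neq_max => im; rewrite !(tnth_nth 0%N) /= modn_small //.
  by apply: h; rewrite size_tuple.
rewrite size_tuple ltnS => im; have := h (inord i).
rewrite neq_max !(tnth_nth 0%N) /= inordK ?modn_small ?ltnS ?im //; exact: ltnW.
Qed.

Lemma poly_agree_smirnov m : poly_agree (smirnovW m.+1) (cyclic_sum x 1 'X 0 1
  m).
Proof.
have -> : cyclic_sum x 1 'X 0 1 m = \sum_(w : m.+1.-tuple 'I_K | smirnov
  (map_tuple val w))
    (\prod_i X (tnth w i))%:P * 'X^(cdes (map_tuple val w)).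
  rewrite cyclic_sum_words [RHS]big_mkcond; apply: eq_bigr => w _.
  rewrite -rmorph_prod smirnov_ord; case: forallP => h.
    rewrite expr_cdes; congr (_ * _); apply: eq_bigr => i _.
    rewrite !tnth_map mxE /=; have := h i;
      rewrite !tnth_map -[_ == tnth _ _]val_eqE /=.
    by case: (ltngtP (tnth w i) (tnth w (ordS i))) => //= _;
      case: (i == ord_max) => //= _; rewrite ?addr0 ?add0r ?expr0 ?expr1.
  have [i] : exists i : 'I_m.+1, ~~ ((i != ord_max) ==>
     (tnth (map_tuple val w) i != tnth (map_tuple val w) (ordS i))).
    by apply/existsP; rewrite -negb_forall; apply/forallP.
  rewrite negb_imply negbK !tnth_map => /andP[im /eqP/val_inj wi].
  by rewrite mulrC (bigD1 i) //= /transfer_mx mxE -wi ltnn (negbTE im) addr0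
    !mul0r.
move=> j; rewrite /smirnovW coef_poly coef_sum.
under eq_bigr do rewrite coefCM coefXn.
(* Beyond degree [m + 1] the right side vanishes too, as [cdes] is at most the length of the
   word. *)
case: ltnP => jm; last first.
  rewrite big1 => [|w _]; first exact: agree0.
  rewrite gtn_eqF ?mulr0 // (leq_ltn_trans _ jm) // -[Z in (_ <= Z)%N]card_ord.
  exact: max_card.
rewrite (eq_bigr (fun w => if cdes (map_tuple val w) == j
   then \prod_i X (tnth w i) else 0)) => [|w _]; last first.
  by rewrite eq_sym; case: eqP; rewrite ?mulr1 ?mulr0.
rewrite -big_mkcondr; apply: agree_formal_sum => w /=.
by split=> [[-> ->]|/andP[-> /eqP]]; rewrite ?eqxx.
Qed.

Lemma fundF_compatible m (s : 'S_m.+1) (f : m.+1.-tuple nat) :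
  ((forall i : 'I_m.+1.-1, nth 0 f i.+1 <= nth 0 f i)%N /\
   (forall i : 'I_m.+1.-1, i \in DESge2 (s^-1)%g -> nth 0 f i.+1 < nth 0 f i)%N)
  <-> compatible (fun i => tnth f (s i)) s.
Proof.
have nthE (i : 'I_m.+1) : nth 0%N f i = tnth f i by rewrite (tnth_nth 0%N).
have invE (i : 'I_m.+1) : nth 0%N (perm_word (s^-1)%g) i = (s^-1)%g i.
  by rewrite -tnth_nth tnth_mktuple.
split=> [[h1 h2]|/forallP h].
  apply/forallP => p; apply/forallP => q; apply/implyP => /eqP e.
  have im : (s p < m)%N by rewrite -ltnS -e.
  have := h1 (Ordinal im); have := h2 (Ordinal im).
  rewrite inE /= -e !nthE !invE !permK addn2 => h2' ->.
  by apply/implyP.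
have cons (i : 'I_m.+1.-1) (p q : 'I_m.+1) : i = p :> nat -> i.+1 = q :> nat ->
    (nth 0 f i.+1 <= nth 0 f i)%N /\
    (i \in DESge2 (s^-1)%g -> nth 0 f i.+1 < nth 0 f i)%N.
  move=> ip iq; have /forallP/(_ ((s^-1)%g q)) := h ((s^-1)%g p).
  rewrite !permKV -ip -iq eqxx inE [in Z in _ -> Z]iq [in Z in _ -> Z]ip.
  by rewrite !nthE !invE addn2 /= => /andP[-> /implyP].
have im (i : 'I_m.+1.-1) : (i < m.+1)%N by apply: ltnW; rewrite ltnS;
  exact: ltn_ord i.
have iS (i : 'I_m.+1.-1) : (i.+1 < m.+1)%N by rewrite ltnS; exact: ltn_ord i.
by split=> i; have [] := cons i (Ordinal (im i)) (Ordinal (iS i)) erefl erefl.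
Qed.

(** Reading [f] along [s] turns the sum over [f] into one over the words with which [s] is
    compatible. After exchanging the sums, [sum_compatible] applies to each word; the corrections,
    one for each constant word, add up to a power sum. *)
Lemma poly_agree_perm_sum m :
  poly_agree
   (\sum_(s : 'S_m.+1) (fundF (DESge2 (s^-1)%g))%:P * 'X^(cdes (perm_word s)))
   (cyclic_sum x 'X 1 (1 + 'X) (-1) m + (1 - 'X) * ('X^m * \sum_i x i ^+ m.+1)).
Proof.
have agreeF (s : 'S_m.+1) : agree (fundF (DESge2 (s^-1)%g))
   (\sum_(w : m.+1.-tuple 'I_K | compatible (fun i => tnth w i : nat) s)
      \prod_i X (tnth w i)).
  pose act (w : m.+1.-tuple 'I_K) := [tuple tnth w ((s^-1)%g i) | i < m.+1].
  have -> : \sum_(w : m.+1.-tuple 'I_K | compatible (fun i => tnth w i : nat) s)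
      \prod_i X (tnth w i) =
    \sum_(f : m.+1.-tuple 'I_K |
        compatible (fun i => tnth (map_tuple val f) (s i)) s) \prod_i X (tnth
          f i).
    rewrite [RHS](reindex act) /=; last first.
      exists (fun f => [tuple tnth f (s i) | i < m.+1]) => w _;
        by apply: eq_from_tnth => i; rewrite !tnth_mktuple ?permK ?permKV.
    apply: eq_big => [w|w _].
      rewrite /compatible; apply: eq_forallb => p; apply: eq_forallb => q.
      by rewrite !tnth_map !tnth_ord_tuple !permK.
    rewrite [LHS](reindex_inj (@perm_inj _ (s^-1)%g)) /=.
    by apply: eq_bigr => i _; rewrite tnth_mktuple.
  by apply: agree_formal_sum => f; exact: fundF_compatible.
have -> : cyclic_sum x 'X 1 (1 + 'X) (-1) m + (1 - 'X) * ('X^m * \sum_i x i ^+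
  m.+1) =
  \sum_(s : 'S_m.+1) (\sum_(w : m.+1.-tuple 'I_K | compatible (fun i =>
    tnth w i : nat) s)
      \prod_i X (tnth w i))%:P * 'X^(cdes (perm_word s)).
  under [RHS]eq_bigr do rewrite rmorph_sum mulr_suml.
  rewrite (exchange_big_dep predT) //= cyclic_sum_words.
  under [RHS]eq_bigr do rewrite -mulr_sumr sum_compatible mulrDr.
  rewrite [RHS]big_split /=; congr (_ + _).
    apply: eq_bigr => w _; rewrite rmorph_prod; congr (_ * _).
    by apply: eq_bigr => i _; rewrite /transfer_mx mxE.
  transitivity (\sum_(w : m.+1.-tuple 'I_K | [forall i, tnth w i == tnth w
    ord0 :> nat])
     (\prod_i X (tnth w i))%:P * ((1 - 'X) * 'X^m)); last first.
    rewrite big_mkcond; apply: eq_bigr => w _; rewrite exprS.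
    by case: ifP => _; rewrite ?mulr0 // mulr1n mulrBl mul1r.
  rewrite (reindex_onto (fun a => [tuple of nseq m.+1 a]) (fun w =>
    tnth w ord0)) /=.
    rewrite mulrA mulr_sumr; apply: eq_big => [a|a _].
      rewrite tnth_nseq eqxx andbT; apply/esym/forallP => i.
      by rewrite !tnth_nseq.
    under eq_bigr do rewrite tnth_nseq.
    by rewrite prodr_const card_ord rmorphXn mulrC.
  move=> w /forallP h; apply: eq_from_tnth => i; rewrite tnth_nseq.
  by apply/val_inj/eqP; rewrite eq_sym; exact: h.
apply: poly_agree_sum => s _; apply: poly_agreeM; last exact: poly_agreeXn.
exact: poly_agreeC.
Qed.

End Transfer.

(** * Recurrences *)

Definition perm_sum n : {poly fps} :=
  \sum_(s : 'S_n) (fundF (DESge2 (s^-1)%g))%:P * 'X^(cdes (perm_word s)).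

Lemma smirnov_recurrence n : (0 < n)%N ->
  \sum_(k < n) ('X^k - 'X) * (sym_e k)%:P * smirnovW (n - k) =
  (1 - 'X) * ('X^(n.-1) * (sym_e n)%:P *+ n).
Proof.
move=> n0; apply: poly_agree_inj => K.
pose x (i : 'I_K) : {poly mpoly K int} := (mpolyX int (mnm1 i))%:P.
exists ((1 - 'X) * ('X^(n.-1) * (elem_poly x)`_n *+ n)); last first.
  apply: poly_agreeM; first exact: poly_agreeB (@poly_agree1 K) (@poly_agreeX
    K).
  apply: poly_agreeMn; apply: poly_agreeM; first exact: poly_agreeXn.
  exact: poly_agree_elem.
rewrite -elem_recurrence //; last by apply: mulfI; rewrite polyX_eq0.
apply: poly_agree_sum => k _; apply: poly_agreeM; last first.
  by have := ltn_ord k; rewrite -subn_gt0; case: (n - k)%N => // m _;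
    exact: poly_agree_smirnov.
apply: poly_agreeM; last exact: poly_agree_elem.
exact: poly_agreeB (@poly_agreeXn K k) (@poly_agreeX K).
Qed.

Lemma perm_sum_recurrence n : (0 < n)%N ->
  \sum_(k < n) ('X^k - 'X) * (sym_h k)%:P * perm_sum (n - k) =
  (1 - 'X) * ('X^(n.-1) * (sym_h n)%:P *+ n).
Proof.
move=> n0; apply: poly_agree_inj => K.
pose x (i : 'I_K) : {poly mpoly K int} := (mpolyX int (mnm1 i))%:P.
exists ((1 - 'X) * ('X^(n.-1) * (complete_poly n x)`_n *+ n)); last first.
  apply: poly_agreeM; first exact: poly_agreeB (@poly_agree1 K) (@poly_agreeX
    K).
  apply: poly_agreeMn; apply: poly_agreeM; first exact: poly_agreeXn.
  exact: poly_agree_complete (leqnn n).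
rewrite -complete_recurrence //; last by apply: mulfI; rewrite polyX_eq0.
apply: poly_agree_sum => k _; apply: poly_agreeM; last first.
  by have := ltn_ord k; rewrite -subn_gt0; case: (n - k)%N => // m _;
    exact: poly_agree_perm_sum.
apply: poly_agreeM; last exact/poly_agree_complete/ltnW.
exact: poly_agreeB (@poly_agreeXn K k) (@poly_agreeX K).
Qed.

(** * Pairs corresponding under the involution *)

(** This is the relation from which [omega] selects a value. Its closure properties come from
    operations on the representing lists; uniqueness enters only at the end, through [omegaE]. *)
Definition omega_pair (f g : fps) : Prop :=
  exists2 s, f = poly_in sym_e s & g = poly_in sym_h s.

Lemma omega_pair0 : omega_pair 0 0.
Proof. by exists [::]; rewrite /poly_in big_nil. Qed.

Lemma omega_pairD f f' g g' : omega_pair f f' -> omega_pair g g' ->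
  omega_pair (f + g) (f' + g').
Proof. by move=> [s -> ->] [r -> ->]; exists (s ++ r);
  rewrite /poly_in big_cat. Qed.

Lemma omega_pairN f f' : omega_pair f f' -> omega_pair (- f) (- f').
Proof.
move=> [s -> ->]; exists [seq (- t.1, t.2) | t <- s];
  rewrite /poly_in big_map -sumrN;
  by apply: eq_bigr => t _; rewrite mulrNz.
Qed.

Lemma omega_pair_mul_sym k f g : omega_pair f g ->
  omega_pair (sym_e k * f) (sym_h k * g).
Proof.
move=> [s -> ->]; exists [seq (t.1, k :: t.2) | t <- s];
  rewrite /poly_in big_map mulr_sumr;
  by apply: eq_bigr => t _; rewrite big_cons mulrzAr.
Qed.

Lemma omega_pair_sym k : omega_pair (sym_e k) (sym_h k).
Proof. by exists [:: (1, [:: k])]; rewrite /poly_in !big_seq1 mulr1z. Qed.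

Definition poly_omega_pair (P Q : {poly fps}) := forall j, omega_pair P`_j Q`_j.

Lemma poly_omega_pairD P P' Q Q' : poly_omega_pair P P' -> poly_omega_pair Q
  Q' ->
  poly_omega_pair (P + Q) (P' + Q').
Proof. by move=> h h' j; rewrite !coefD; apply: omega_pairD. Qed.

Lemma poly_omega_pairN P P' : poly_omega_pair P P' -> poly_omega_pair (- P) (-
  P').
Proof. by move=> h j; rewrite !coefN; apply: omega_pairN. Qed.

Lemma poly_omega_pairXn k P P' : poly_omega_pair P P' ->
  poly_omega_pair ('X^k * P) ('X^k * P').
Proof. by move=> h j; rewrite !coefXnM; case: ifP => // _;
  exact: omega_pair0. Qed.

Lemma poly_omega_pair_mul_sym k P P' : poly_omega_pair P P' ->
  poly_omega_pair ((sym_e k)%:P * P) ((sym_h k)%:P * P').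
Proof. by move=> h j; rewrite !coefCM; apply: omega_pair_mul_sym. Qed.

Lemma poly_omega_pair0 : poly_omega_pair 0 0.
Proof. by move=> j; rewrite coef0; exact: omega_pair0. Qed.

Lemma poly_omega_pairMn n P P' : poly_omega_pair P P' ->
  poly_omega_pair (P *+ n) (P' *+ n).
Proof.
move=> h; elim: n => [|n IH]; first exact: poly_omega_pair0.
by rewrite !mulrS; apply: poly_omega_pairD.
Qed.

Lemma poly_omega_pair_sym k : poly_omega_pair (sym_e k)%:P (sym_h k)%:P.
Proof.
by move=> j; rewrite !coefC; case: eqP => _;
  [exact: omega_pair_sym|exact: omega_pair0].
Qed.

Lemma poly_omega_pair_sub k P P' : poly_omega_pair P P' ->
  poly_omega_pair (('X^k - 'X) * P) (('X^k - 'X) * P').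
Proof.
move=> h; rewrite !mulrBl; apply: poly_omega_pairD;
  first exact: poly_omega_pairXn.
by apply: poly_omega_pairN; exact: (@poly_omega_pairXn 1).
Qed.

(** Multiplication by [1 - 'X] takes differences of successive coefficients, which are summed back
    by induction. *)
Lemma poly_omega_pair_cancel P P' :
  poly_omega_pair ((1 - 'X) * P) ((1 - 'X) * P') -> poly_omega_pair P P'.
Proof.
move=> h; elim=> [|j IH].
  by have := h 0%N; rewrite !mulrBl !mul1r !coefB !coefXM !subr0.
have := omega_pairD (h j.+1) IH.
by rewrite !mulrBl !mul1r !coefB !coefXM /= !subrK.
Qed.

Lemma sym_e0 : sym_e 0 = 1.
Proof.
apply: fpsP => m; rewrite fcoef_sym_e -sym_h0 fcoef_sym_h.
by case: (enum_mset m) => //=; rewrite andbF.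
Qed.

(** The term [k = 0] of each recurrence is [1 - 'X] times the sum of size [n]. Isolating it
    expresses both sides by one formula in the smaller sums, with [sym_e] on the left and [sym_h] on
    the right. *)
Lemma smirnov_perm_sum_pair n : (0 < n)%N ->
  poly_omega_pair (smirnovW n) (perm_sum n).
Proof.
elim/ltn_ind: n => -[//|n] IH n0; apply: poly_omega_pair_cancel.
have := smirnov_recurrence n0; have := perm_sum_recurrence n0.
rewrite !big_ord_recl /= !subn0 sym_h0 sym_e0 !mulr1 expr0.
move=> /(canRL (addrK _)) -> /(canRL (addrK _)) ->.
apply: poly_omega_pairD.
  rewrite -(expr0 'X); apply: poly_omega_pair_sub; apply: poly_omega_pairMn.
  by apply: poly_omega_pairXn; exact: poly_omega_pair_sym.
apply: poly_omega_pairN; elim/big_ind2: _ => [|? ? ? ?|k _].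
- exact: poly_omega_pair0.
- exact: poly_omega_pairD.
rewrite -!mulrA; apply: poly_omega_pair_sub; apply: poly_omega_pair_mul_sym.
by apply: IH; rewrite /bump /=; have := ltn_ord k; lia.
Qed.

Theorem corollary5p3 (n : nat) (hn : (0 < n)%N) :
  map_poly omega (smirnovW n) =
  \sum_(s : 'S_n) (fundF (DESge2 (s^-1)%g))%:P * 'X^(cdes (perm_word s)).
Proof.
(* [coef_map_id0] asks for [omega 0 = 0], the case of the empty list in [omegaE]. *)
apply/polyP => j; rewrite coef_map_id0; last first.
  by have := omegaE [::]; rewrite /poly_in !big_nil.
by have [s -> ->] := smirnov_perm_sum_pair hn j; exact: omegaE.
Qed.
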